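(* Let $(\mathcal A,\varphi)$ be a non-commutative probability space over $k\supseteq\mathbb R$ and $H=T(T(\mathcal A))$. For $\Phi\in G_H(k)$ and $t\ge0$ let $$\mathbb B_t(\Phi):=\big(\mathcal E_\prec((1+t)\log^\prec\Phi)\big)^{\Box_\succ\frac1{1+t}}.$$ Then the set automorphisms $\mathbb B_t$ of $G_H(k)$ form a one-parameter semigroup, i.e. $\mathbb B_t\circ\mathbb B_s=\mathbb B_{t+s}$ for all $s,t\ge0$.
   Context: $k$ is a field of characteristic zero (containing the reals, so that the parameter $t\ge0$ makes sense as a scalar). Double tensor algebra. $T(\mathcal A)=\bigoplus_{n>0}\mathcal A^{\otimes n}$, elements written as words $a_1\cdots a_n$ ($=a_1\otimes\cdots\otimes a_n$). $\overline H=\overline T(T(\mathcal A))=\bigoplus_{n\ge0}T(\mathcal A)^{\otimes n}=k\mathbf 1\oplus H$ with concatenation product $w_1|\cdots|w_m$. For $S=\{s_1<\dots<s_p\}\subseteq[n]$, $a_S:=a_{s_1}\cdots a_{s_p}$ ($a_\emptyset=\mathbf 1$); if $J_1,\dots,J_l$ (in increasing order) are the maximal intervals of consecutive integers in $[n]\setminus S$, $a_{J^S_{[n]}}:=a_{J_1}|\cdots|a_{J_l}$. Coproduct: $\Delta(a_1\cdots a_n)=\sum_{S\subseteq[n]}a_S\otimes a_{J^S_{[n]}}$, extended multiplicatively. $\Delta^+_\prec(a_1\cdots a_n):=\sum_{1\in S}a_S\otimes a_{J^S_{[n]}}$, $\Delta^+_\succ(a_1\cdots a_n):=\sum_{1\notin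 S}a_S\otimes a_{J^S_{[n]}}$, extended by $\Delta^+_{\prec}(w_1|\cdots|w_m)=\Delta^+_\prec(w_1)\Delta(w_2)\cdots\Delta(w_m)$ (likewise $\Delta^+_\succ$); $\Delta_\prec(x)=\Delta^+_\prec(x)-x\otimes\mathbf 1$, $\Delta_\succ(x)=\Delta^+_\succ(x)-\mathbf 1\otimes x$ on $H$. $e$ is the augmentation; $f*g=m_k(f\otimes g)\Delta$ for linear forms on $\overline H$; for linear forms vanishing on $\mathbf 1$, $f\prec g=m_k(f\otimes g)\Delta_\prec$, $f\succ g=m_k(f\otimes g)\Delta_\succ$, extended by $e\succ f=f=f\prec e$, $e\prec f=0=f\succ e$. $G_H(k)$: characters (unital algebra maps $\overline H\to k$); $g_H(k)$: linear forms $\gamma$ with $\gamma(\mathbf 1)=0$, $\gamma(x|y)=0$ for $x,y\in H$. $\mathcal E_\prec(\alpha)$ (resp. $\mathcal E_\succ(\alpha)$), for $\alpha\in g_H(k)$, is the unique solution of $\Phi=e+\alpha\prec\Phi$ (resp. $\Phi=e+\Phi\succ\alpha$); both maps are bijections $g_H(k)\to G_H(k)$ with inverses $\log^\prec(\Phi)=(\Phi-e)\prec\Phi^{-1}$ and $\log^\succ(\Phi)=\Phi^{-1}\succ(\Phi-e)$. Half-shuffle power: for $\Psi\in G_H(k)$, $s\in k$, $\Psi^{\Box_\succ s}:=\mathcal E_\succ(s\log^\succ(\Psi))$. *)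

(* Defs.v *)
From HB Require Import structures.
From mathcomp Require Import all_boot all_order all_algebra.
From mathcomp Require Import finmap monalg.
From mathcomp Require Import boolp classical_sets functions reals.

Set Implicit Arguments.
Unset Strict Implicit.
Unset Printing Implicit Defensive.

Import GRing.Theory.

Local Open Scope quotient_scope.
Local Open Scope ring_scope.

Section SubmoduleQuotient.
Context {k : fieldType} {M : lmodType k}.

Definition submodule_set (S : set M) : Prop :=
  S 0 /\ forall (c : k) (x y : M), S x -> S y -> S (c *: x + y).

Definition spanned (R : set M) : {pred M} := fun x =>
  `[< forall S : set M, submodule_set S -> (R `<=` S)%classic -> S x >].

Context {R : set M}.

Lemma spannedP x : reflect
  (forall S : set M, submodule_set S -> (R `<=` S)%classic -> S x)
  (x \in spanned R).
Proof. exact: asboolP. Qed.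

Lemma spanned_closed : submod_closed (spanned R).
Proof.
split=> [|c x y /spannedP Sx /spannedP Sy]; apply/spannedP => S subS RS.
  exact: subS.1.
by apply: subS.2; [exact: Sx | exact: Sy].
Qed.

HB.instance Definition _ := GRing.isSubmodClosed.Build k M (spanned R)
  (GRing.submod_closed_semi spanned_closed).

End SubmoduleQuotient.

(* The k-module presented by a set W of generators and a set R of relators,
   i.e. the quotient of the free k-module on W by the span of R. The operations
   are locked so that unification never unfolds the quotient. *)
Section Presentation.
Context {k : fieldType} {W : choiceType}.
Implicit Types (R : set {malg k[W]}) (w : W).

Definition pres R : Type := Quotient.quot (spanned R).

HB.instance Definition _ R := Choice.on (pres R).

Definition pres_pi {R} : {malg k[W]} -> pres R :=
  locked \pi_(Quotient.quot (spanned R)).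
Definition pres_repr {R} : pres R -> {malg k[W]} :=
  locked (@repr _ (Quotient.quot (spanned R))).

Lemma pres_reprK R : cancel (@pres_repr R) pres_pi.
Proof. by rewrite /pres_repr /pres_pi -!lock; exact: reprK. Qed.

Lemma pres_piP R x y : reflect (@pres_pi R x = pres_pi y) (x - y \in spanned R).
Proof. by rewrite /pres_pi -lock Quotient.idealrBE; exact: eqP. Qed.

Definition pres_zero R : pres R := locked (pres_pi 0).
Definition pres_add R : pres R -> pres R -> pres R :=
  locked (fun p q => pres_pi (pres_repr p + pres_repr q)).
Definition pres_opp R : pres R -> pres R :=
  locked (fun q => pres_pi (- pres_repr q)).
Definition pres_scale R : k -> pres R -> pres R :=
  locked (fun c q => pres_pi (c *: pres_repr q)).

Lemma pres_pi_repr R x : pres_repr (@pres_pi R x) - x \in spanned R.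
Proof. by apply/pres_piP; rewrite pres_reprK. Qed.

Lemma pres_add_pi R x y : pres_add (@pres_pi R x) (pres_pi y) = pres_pi (x + y).
Proof.
rewrite /pres_add -lock; apply/pres_piP; rewrite opprD addrACA.
by apply: rpredD; exact: pres_pi_repr.
Qed.

Lemma pres_opp_pi R x : pres_opp (@pres_pi R x) = pres_pi (- x).
Proof.
rewrite /pres_opp -lock; apply/pres_piP; rewrite -opprD rpredN.
exact: pres_pi_repr.
Qed.

Lemma pres_addA R : associative (@pres_add R).
Proof.
move=> x y z; rewrite -(pres_reprK x) -(pres_reprK y) -(pres_reprK z).
by rewrite !pres_add_pi addrA.
Qed.

Lemma pres_addC R : commutative (@pres_add R).
Proof. by move=> x y; rewrite /pres_add -lock addrC. Qed.

Lemma pres_add0 R : left_id (pres_zero R) (@pres_add R).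
Proof.
by move=> x; rewrite /pres_zero -lock -(pres_reprK x) pres_add_pi add0r.
Qed.

Lemma pres_addN R : left_inverse (pres_zero R) (@pres_opp R) (@pres_add R).
Proof.
move=> x; rewrite /pres_zero -lock -(pres_reprK x) pres_opp_pi pres_add_pi.
by rewrite addNr.
Qed.

HB.instance Definition _ R := GRing.isZmodule.Build (pres R)
  (@pres_addA R) (@pres_addC R) (@pres_add0 R) (@pres_addN R).

Lemma pres_pi_zmod R : zmod_morphism (@pres_pi R).
Proof. by move=> x y; rewrite -pres_add_pi -pres_opp_pi. Qed.

HB.instance Definition _ R :=
  GRing.isZmodMorphism.Build _ _ (@pres_pi R) (pres_pi_zmod R).

Lemma pres_scale_pi R c x : pres_scale c (@pres_pi R x) = pres_pi (c *: x).
Proof.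
rewrite /pres_scale -lock; apply/pres_piP; rewrite -scalerBr; apply: rpredZ.
exact: pres_pi_repr.
Qed.

Lemma pres_scaleA R a b (v : pres R) :
  pres_scale a (pres_scale b v) = pres_scale (a * b) v.
Proof. by rewrite -(pres_reprK v) !pres_scale_pi scalerA. Qed.

Lemma pres_scale1 R : left_id 1 (@pres_scale R).
Proof. by move=> v; rewrite -(pres_reprK v) pres_scale_pi scale1r. Qed.

Lemma pres_scaleDr R : right_distributive (@pres_scale R) +%R.
Proof.
move=> a u v; rewrite -(pres_reprK u) -(pres_reprK v) -raddfD !pres_scale_pi.
by rewrite -raddfD scalerDr.
Qed.

Lemma pres_scaleDl R (v : pres R) : {morph (@pres_scale R)^~ v : a b / a + b}.
Proof.
by move=> a b; rewrite -(pres_reprK v) !pres_scale_pi -raddfD scalerDl.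
Qed.

HB.instance Definition _ R := GRing.Zmodule_isLmodule.Build k (pres R)
  (@pres_scaleA R) (@pres_scale1 R) (@pres_scaleDr R) (@pres_scaleDl R).

Lemma pres_pi_scalable R : scalable (@pres_pi R).
Proof. by move=> c x; rewrite -pres_scale_pi. Qed.

HB.instance Definition _ R :=
  GRing.isScalable.Build _ _ _ _ (@pres_pi R) (pres_pi_scalable R).

Definition gen {R} : W -> pres R := locked (fun w => pres_pi << w >>).

Lemma genE R w : @gen R w = pres_pi << w >>.
Proof. by rewrite /gen -lock. Qed.

Definition malg_ext {N : lmodType k} (f : W -> N) : {malg k[W]} -> N :=
  locked (fun x => \sum_(w <- msupp x) x@_w *: f w).

(* The linear map sending each generator w to f w; this is only meaningful
   when f maps the relators to 0 (see pres_lift_linear). *)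
Definition pres_lift {R} {N : lmodType k} (f : W -> N) : pres R -> N :=
  locked (malg_ext f \o pres_repr).

Lemma malg_ext_sub (N : lmodType k) (f : W -> N) (x : {malg k[W]}) (d : {fset W}) :
  (msupp x `<=` d)%fset -> malg_ext f x = \sum_(w <- d) x@_w *: f w.
Proof.
move=> le; rewrite /malg_ext -lock [LHS](big_fset_incl _ le) => //= w _.
by move=> /mcoeff_outdom ->; rewrite scale0r.
Qed.

Lemma malg_ext_linear (N : lmodType k) (f : W -> N) : linear (malg_ext f).
Proof.
move=> c x y.
pose d := (msupp x `|` msupp y `|` msupp (c *: x + y))%fset.
have dx : (msupp x `<=` d)%fset by rewrite /d -fsetUA fsubsetUl.
have dy : (msupp y `<=` d)%fset by rewrite /d fsetUAC fsubsetUr.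
rewrite (malg_ext_sub f dx) (malg_ext_sub f dy).
rewrite (@malg_ext_sub _ f _ d) ?fsubsetUr // scaler_sumr -big_split /=.
by apply: eq_bigr => w _; rewrite mcoeffD mcoeffZ scalerDl scalerA.
Qed.

HB.instance Definition _ (N : lmodType k) (f : W -> N) :=
  GRing.isLinear.Build k {malg k[W]} N _ (malg_ext f) (malg_ext_linear f).

Lemma malg_extU (N : lmodType k) (f : W -> N) w : malg_ext f << w >> = f w.
Proof.
rewrite (@malg_ext_sub _ f _ [fset w]%fset) ?msuppU_le //.
by rewrite big_seq_fset1 mcoeffUU scale1r.
Qed.

Lemma malg_ext_rel (N : lmodType k) (f : W -> N) c w w1 w2 :
  malg_ext f (<< w >> - (c *: << w1 >> + << w2 >>)) = f w - (c *: f w1 + f w2).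
Proof. by rewrite linearB linearP /= !malg_extU. Qed.

Section Lift.
Context {R : set {malg k[W]}} {N : lmodType k} {f : W -> N}.
Hypothesis fR : forall r, R r -> malg_ext f r = 0.

Lemma pres_lift_pi x : pres_lift f (@pres_pi R x) = malg_ext f x.
Proof.
rewrite /pres_lift -lock; apply/eqP; rewrite -subr_eq0 -linearB /=; apply/eqP.
suff /spannedP/(_ [set r | malg_ext f r = 0]%classic) :
    pres_repr (@pres_pi R x) - x \in spanned R.
  apply=> [|r /fR //]; split=> [|c u v fu fv]; first exact: linear0.
  by rewrite /= linearP /= fu fv scaler0 addr0.
by apply/pres_piP; rewrite pres_reprK.
Qed.

Lemma pres_lift_linear : linear (pres_lift f : pres R -> N).
Proof.
move=> c x y; rewrite -(pres_reprK x) -(pres_reprK y) -linearP !pres_lift_pi.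
exact: linearP.
Qed.

Lemma pres_liftE w : pres_lift f (@gen R w) = f w.
Proof. by rewrite genE pres_lift_pi malg_extU. Qed.

End Lift.

Lemma pres_ext R (N : lmodType k) (f g : pres R -> N) : linear f -> linear g ->
  (forall w, f (gen w) = g (gen w)) -> f =1 g.
Proof.
move=> lf lg fg q; rewrite -(pres_reprK q) (monalgE (pres_repr q)).
pose F : {linear pres R -> N} := HB.pack f (GRing.isLinear.Build _ _ _ _ f lf).
pose G : {linear pres R -> N} := HB.pack g (GRing.isLinear.Build _ _ _ _ g lg).
rewrite -[f]/(F : _ -> _) -[g]/(G : _ -> _) !linear_sum; apply: eq_bigr => w _.
have -> : << (pres_repr q)@_w *g w >> = (pres_repr q)@_w *: << w >> :> {malg k[W]}.
  by apply/malgP => w'; rewrite mcoeffZ !mcoeffU mulrnAr mulr1.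
by rewrite !linearZ /= -genE fg.
Qed.

End Presentation.

Definition multilinear {k : fieldType} {V N : lmodType k} (p : pred nat)
    (f : seq V -> N) : Prop :=
  forall (c : k) (x y : V) (u v : seq V), p (size u + size v).+1 ->
    f (u ++ (c *: x + y) :: v) = c *: f (u ++ x :: v) + f (u ++ y :: v).

(* tsum p V is the direct sum of the tensor powers of V of degree n, over the
   n such that p n: words of letters in V, modulo multilinearity. *)
Section TensorSum.
Context {k : fieldType}.

Definition lword (p : pred nat) (V : lmodType k) : choiceType :=
  {s : seq V | p (size s)}.

Definition tsum_rel (p : pred nat) (V : lmodType k) :
    set {malg k[lword p V]} :=
  [set r | exists (c : k) (x y : V) (u v : seq V) (w wx wy : lword p V),
     [/\ val w = u ++ (c *: x + y) :: v, val wx = u ++ x :: v,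
         val wy = u ++ y :: v & r = << w >> - (c *: << wx >> + << wy >>)]]%classic.

Definition tsum (p : pred nat) (V : lmodType k) : Type := pres (@tsum_rel p V).

HB.instance Definition _ p V := GRing.Lmodule.on (tsum p V).

Context {p : pred nat} {V : lmodType k}.

(* The pure tensor x_1 ... x_n; it is 0 when p n does not hold. *)
Definition word (s : seq V) : tsum p V :=
  if insub s is Some w then gen w else 0.

Definition tsum_lift {N : lmodType k} (f : seq V -> N) : tsum p V -> N :=
  pres_lift (f \o val).

Lemma word_val (w : lword p V) : word (val w) = gen w.
Proof. by rewrite /word valK. Qed.

Lemma word_multilinear : multilinear p word.
Proof.
move=> c x y u v puv.
have sz z : p (size (u ++ z :: v)) by rewrite size_cat /= addnS.
pose w z : lword p V := Sub (u ++ z :: v) (sz z).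
have wE z : word (u ++ z :: v) = gen (w z) by rewrite -word_val SubK.
rewrite !wE !genE -linearP; apply/pres_piP; apply/spannedP => S _; apply.
by exists c, x, y, u, v, (w (c *: x + y)), (w x), (w y); rewrite !SubK.
Qed.

Section Lift.
Context {N : lmodType k} {f : seq V -> N}.
Hypothesis f_mul : multilinear p f.

Let f_rel r : @tsum_rel p V r -> malg_ext (f \o val) r = 0.
Proof.
move=> [c [x [y [u [v [w [wx [wy [Ew Ex Ey ->]]]]]]]]].
rewrite malg_ext_rel /= Ew Ex Ey f_mul ?subrr //.
by have := valP wx; rewrite Ex size_cat /= addnS.
Qed.

Lemma tsum_lift_linear : linear (tsum_lift f).
Proof. exact: pres_lift_linear. Qed.

Lemma tsum_liftE s : p (size s) -> tsum_lift f (word s) = f s.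
Proof.
by move=> ps; rewrite -[s](SubK (lword p V) ps) word_val /tsum_lift pres_liftE.
Qed.

End Lift.

Lemma tsum_ext (N : lmodType k) (f g : tsum p V -> N) : linear f -> linear g ->
  (forall s, p (size s) -> f (word s) = g (word s)) -> f =1 g.
Proof.
move=> lf lg fg; apply: pres_ext => // w.
by rewrite -word_val fg //; exact: valP w.
Qed.

End TensorSum.

Notation posn := (fun n : nat => (0 < n)%N).

Lemma scaler_exchange (k : comPzRingType) (V : lmodType k) (c d : k)
    (x x' y y' : V) :
  c *: (d *: x + x') + (d *: y + y') = d *: (c *: x + y) + (c *: x' + y').
Proof. by rewrite !scalerDr !scalerA (mulrC c) addrACA. Qed.

Section TensorAlgebra.
Context {k : fieldType} {V : lmodType k}.
Local Notation T := (tsum xpredT V).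
Local Notation tw := (word : seq V -> T).

Definition talg_one : T := word [::].

Definition talg_mul (x y : T) : T :=
  tsum_lift (fun u => tsum_lift (fun v => tw (u ++ v)) y) x.

Let inner_mul (u : seq V) : multilinear xpredT (fun v => tw (u ++ v)).
Proof. by move=> c x y a b _; rewrite !catA word_multilinear. Qed.

Let outer_mul (y : T) :
  multilinear xpredT (fun u => tsum_lift (fun v => tw (u ++ v)) y).
Proof.
move=> c x x' a b _; move: y; apply: tsum_ext.
- exact/tsum_lift_linear/inner_mul.
- move=> d y y'; rewrite !(tsum_lift_linear (inner_mul _)).
  exact: scaler_exchange.
move=> v _; rewrite (tsum_liftE (inner_mul _)) //.
rewrite (tsum_liftE (inner_mul (a ++ x :: b))) //.
rewrite (tsum_liftE (inner_mul (a ++ x' :: b))) //.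
by rewrite -!catA !cat_cons word_multilinear.
Qed.

Lemma talg_mulE u v : talg_mul (word u) (word v) = word (u ++ v).
Proof. by rewrite /talg_mul !(tsum_liftE (outer_mul _), tsum_liftE (inner_mul _)). Qed.

Lemma talg_mul_linearl y : linear (talg_mul^~ y).
Proof. exact/tsum_lift_linear/outer_mul. Qed.

Lemma talg_mul_linearr x : linear (talg_mul x).
Proof.
move=> c y y'; move: x; apply: tsum_ext.
- exact: talg_mul_linearl.
- move=> d x x'; rewrite !talg_mul_linearl; exact: scaler_exchange.
- move=> u _; rewrite /talg_mul !(tsum_liftE (outer_mul _)) //.
  exact/tsum_lift_linear/inner_mul.
Qed.

Lemma talg_mulA : associative talg_mul.
Proof.
move=> x y z; move: x; apply: tsum_ext.
- exact: talg_mul_linearl.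
- by move=> c x x'; rewrite !talg_mul_linearl.
move=> u _; move: y; apply: tsum_ext.
- by move=> c y y'; rewrite talg_mul_linearl talg_mul_linearr.
- by move=> c y y'; rewrite talg_mul_linearr talg_mul_linearl.
move=> v _; move: z; apply: tsum_ext.
- by move=> c z z'; rewrite !talg_mul_linearr.
- by move=> c z z'; rewrite !talg_mul_linearr.
by move=> w _; rewrite !talg_mulE catA.
Qed.

Lemma talg_mul1 : left_id talg_one talg_mul.
Proof.
apply: tsum_ext => //; first exact: talg_mul_linearr.
by move=> s _; rewrite talg_mulE.
Qed.

Lemma talg_mulr1 : right_id talg_one talg_mul.
Proof.
apply: tsum_ext => //; first exact: talg_mul_linearl.
by move=> s _; rewrite talg_mulE cats0.
Qed.

Lemma talg_mulDl : left_distributive talg_mul +%R.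
Proof. by move=> x y z; have := talg_mul_linearl z 1 x y; rewrite !scale1r. Qed.

Lemma talg_mulDr : right_distributive talg_mul +%R.
Proof. by move=> x y z; have := talg_mul_linearr x 1 y z; rewrite !scale1r. Qed.

Lemma talg_mulZl (c : k) x y : c *: talg_mul x y = talg_mul (c *: x) y.
Proof.
have mul0y : talg_mul 0 y = 0.
  by apply: (addIr (talg_mul 0 y)); rewrite -talg_mulDl !add0r.
by have := talg_mul_linearl y c x 0; rewrite mul0y !addr0.
Qed.

Lemma talg_mulZr (c : k) x y : c *: talg_mul x y = talg_mul x (c *: y).
Proof.
have mulx0 : talg_mul x 0 = 0.
  by apply: (addIr (talg_mul x 0)); rewrite -talg_mulDr !add0r.
by have := talg_mul_linearr x c y 0; rewrite mulx0 !addr0.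
Qed.

Definition talg_counit : T -> k :=
  @tsum_lift _ _ _ k^o (fun s : seq V => (nilp s)%:R).

Let counit_mul : multilinear xpredT (fun s : seq V => (nilp s)%:R : k^o).
Proof.
by move=> c x y u v _; rewrite /nilp !size_cat /= !addnS /= scaler0 addr0.
Qed.

Lemma talg_counit_scalar : scalar talg_counit.
Proof. exact: (tsum_lift_linear counit_mul). Qed.

Lemma talg_counitE s : talg_counit (word s) = (nilp s)%:R.
Proof. exact: (tsum_liftE counit_mul). Qed.

Lemma talg_one_neq0 : talg_one != 0.
Proof.
apply/eqP => /(congr1 talg_counit); rewrite talg_counitE => one0.
have := talg_counit_scalar (-1) 0 0.
by rewrite scaler0 addr0 -one0 mulr1 addNr => /eqP; rewrite oner_eq0.
Qed.

End TensorAlgebra.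

(* tens V = T(V) only has the positive degrees; talg V is the unital tensor
   algebra. *)
Definition tens {k : fieldType} (V : lmodType k) : Type := tsum posn V.
Definition talg {k : fieldType} (V : lmodType k) : Type := tsum xpredT V.

HB.instance Definition _ (k : fieldType) (V : lmodType k) :=
  GRing.Lmodule.on (tens V).
HB.instance Definition _ (k : fieldType) (V : lmodType k) :=
  GRing.Lmodule.on (talg V).


Section TensorAlgebraInstances.
Context {k : fieldType} {V : lmodType k}.

HB.instance Definition _ := GRing.Zmodule_isNzRing.Build (talg V)
  talg_mulA talg_mul1 talg_mulr1 talg_mulDl talg_mulDr talg_one_neq0.

HB.instance Definition _ :=
  GRing.Lmodule_isLalgebra.Build k (talg V) talg_mulZl.

HB.instance Definition _ :=
  GRing.Lalgebra_isAlgebra.Build k (talg V) talg_mulZr.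

End TensorAlgebraInstances.

Definition bilin {k : fieldType} {U V N : lmodType k} (f : U -> V -> N) : Prop :=
  (forall v, linear (f^~ v)) /\ (forall u, linear (f u)).

Section TensorProduct.
Context {k : fieldType}.

Definition tprod_rel (U V : lmodType k) : set {malg k[(U * V)%type]} :=
  [set r | exists (c : k) (u u' : U) (v v' : V),
      r = << (c *: u + u', v) >> - (c *: << (u, v) >> + << (u', v) >>)
   \/ r = << (u, c *: v + v') >> - (c *: << (u, v) >> + << (u, v') >>)]%classic.

Definition tprod (U V : lmodType k) : Type := pres (@tprod_rel U V).

HB.instance Definition _ U V := GRing.Lmodule.on (tprod U V).

Section Theory.
Context {U V : lmodType k}.

Definition pure (u : U) (v : V) : tprod U V := gen (u, v).

Definition tprod_lift {N : lmodType k} (f : U -> V -> N) : tprod U V -> N :=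
  pres_lift (fun p => f p.1 p.2).

Lemma pure_bilin : bilin pure.
Proof.
split=> [v c u u'|u c v v']; rewrite /pure !genE -linearP.
- apply/pres_piP; apply/spannedP => S _; apply.
  by exists c, u, u', v, v; left.
- apply/pres_piP; apply/spannedP => S _; apply.
  by exists c, u, u, v, v'; right.
Qed.

Section Lift.
Context {N : lmodType k} {f : U -> V -> N}.
Hypothesis f_bilin : bilin f.

Let f_rel r : @tprod_rel U V r -> malg_ext (fun p => f p.1 p.2) r = 0.
Proof.
move=> [c [u [u' [v [v' [->|->]]]]]]; rewrite malg_ext_rel /=.
- by rewrite (f_bilin.1 v) subrr.
- by rewrite (f_bilin.2 u) subrr.
Qed.

Lemma tprod_lift_linear : linear (tprod_lift f).
Proof. exact: pres_lift_linear. Qed.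

Lemma tprod_liftE u v : tprod_lift f (pure u v) = f u v.
Proof. by rewrite /tprod_lift pres_liftE. Qed.

End Lift.

Lemma tprod_ext (N : lmodType k) (f g : tprod U V -> N) : linear f -> linear g ->
  (forall u v, f (pure u v) = g (pure u v)) -> f =1 g.
Proof. by move=> lf lg fg; apply: pres_ext => // -[u v]; exact: fg. Qed.

End Theory.
End TensorProduct.

(* The algebra structure of A (x) B: (a (x) b)(a' (x) b') = aa' (x) bb'. *)
Section TensorProductAlgebra.
Context {k : fieldType} {A B : algType k}.
Local Notation T := (tprod A B).

Definition tprod_one : T := pure 1 1.

Definition tprod_mul (x y : T) : T :=
  tprod_lift (fun a b => tprod_lift (fun a' b' => pure (a * a') (b * b')) y) x.

Let inner_mul (a : A) (b : B) :
  bilin (fun (a' : A) (b' : B) => pure (a * a') (b * b')).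
Proof.
split=> [b' c x x'|a' c x x'] /=.
- by rewrite mulrDr -scalerAr (pure_bilin.1 (b * b')).
- by rewrite mulrDr -scalerAr (pure_bilin.2 (a * a')).
Qed.

Let outer_mul (y : T) :
  bilin (fun a b => tprod_lift (fun a' b' => pure (a * a') (b * b')) y).
Proof.
split=> [b c a a'|a c b b'] /=; move: y; apply: tprod_ext.
- exact/tprod_lift_linear/inner_mul.
- move=> d y y'; rewrite !(tprod_lift_linear (inner_mul _ _)).
  exact: scaler_exchange.
- move=> u v; rewrite (tprod_liftE (inner_mul _ b)).
  rewrite (tprod_liftE (inner_mul a b)) (tprod_liftE (inner_mul a' b)).
  by rewrite mulrDl -scalerAl (pure_bilin.1 (b * v)).
- exact/tprod_lift_linear/inner_mul.
- move=> d y y'; rewrite !(tprod_lift_linear (inner_mul _ _)).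
  exact: scaler_exchange.
- move=> u v; rewrite (tprod_liftE (inner_mul a _)).
  rewrite (tprod_liftE (inner_mul a b)) (tprod_liftE (inner_mul a b')).
  by rewrite mulrDl -scalerAl (pure_bilin.2 (a * u)).
Qed.

Lemma tprod_mulE a b a' b' :
  tprod_mul (pure a b) (pure a' b') = pure (a * a') (b * b').
Proof.
by rewrite /tprod_mul (tprod_liftE (outer_mul _)) (tprod_liftE (inner_mul _ _)).
Qed.

Lemma tprod_mul_linearl y : linear (tprod_mul^~ y).
Proof. exact/tprod_lift_linear/outer_mul. Qed.

Lemma tprod_mul_linearr x : linear (tprod_mul x).
Proof.
move=> c y y'; move: x; apply: tprod_ext.
- exact: tprod_mul_linearl.
- by move=> d x x'; rewrite !tprod_mul_linearl; exact: scaler_exchange.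
- move=> a b; rewrite /tprod_mul !(tprod_liftE (outer_mul _)).
  exact/tprod_lift_linear/inner_mul.
Qed.

Lemma tprod_mulA : associative tprod_mul.
Proof.
move=> x y z; move: x; apply: tprod_ext.
- exact: tprod_mul_linearl.
- by move=> c x x'; rewrite !tprod_mul_linearl.
move=> a b; move: y; apply: tprod_ext.
- by move=> c y y'; rewrite tprod_mul_linearl tprod_mul_linearr.
- by move=> c y y'; rewrite tprod_mul_linearr tprod_mul_linearl.
move=> a' b'; move: z; apply: tprod_ext.
- by move=> c z z'; rewrite !tprod_mul_linearr.
- by move=> c z z'; rewrite !tprod_mul_linearr.
by move=> a'' b''; rewrite !tprod_mulE !mulrA.
Qed.

Lemma tprod_mul1 : left_id tprod_one tprod_mul.
Proof.
apply: tprod_ext => //; first exact: tprod_mul_linearr.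
by move=> a b; rewrite tprod_mulE !mul1r.
Qed.

Lemma tprod_mulr1 : right_id tprod_one tprod_mul.
Proof.
apply: tprod_ext => //; first exact: tprod_mul_linearl.
by move=> a b; rewrite tprod_mulE !mulr1.
Qed.

Lemma tprod_mulDl : left_distributive tprod_mul +%R.
Proof. by move=> x y z; have := tprod_mul_linearl z 1 x y; rewrite !scale1r. Qed.

Lemma tprod_mulDr : right_distributive tprod_mul +%R.
Proof. by move=> x y z; have := tprod_mul_linearr x 1 y z; rewrite !scale1r. Qed.

Lemma tprod_mulZl (c : k) x y : c *: tprod_mul x y = tprod_mul (c *: x) y.
Proof.
have mul0y : tprod_mul 0 y = 0.
  by apply: (addIr (tprod_mul 0 y)); rewrite -tprod_mulDl !add0r.
by have := tprod_mul_linearl y c x 0; rewrite mul0y !addr0.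
Qed.

Lemma tprod_mulZr (c : k) x y : c *: tprod_mul x y = tprod_mul x (c *: y).
Proof.
have mulx0 : tprod_mul x 0 = 0.
  by apply: (addIr (tprod_mul x 0)); rewrite -tprod_mulDr !add0r.
by have := tprod_mul_linearr x c y 0; rewrite mulx0 !addr0.
Qed.

HB.instance Definition _ := GRing.Zmodule_isPzRing.Build (tprod A B)
  tprod_mulA tprod_mul1 tprod_mulr1 tprod_mulDl tprod_mulDr.

Lemma tprod_scaleAl (c : k) (x y : tprod A B) : c *: (x * y) = (c *: x) * y.
Proof. exact: tprod_mulZl. Qed.

Lemma tprod_scaleAr (c : k) (x y : tprod A B) : c *: (x * y) = x * (c *: y).
Proof. exact: tprod_mulZr. Qed.

End TensorProductAlgebra.

(* The double tensor algebra. A bar-word w_1|...|w_m is word [:: w_1; ...; w_m],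
   and the bar product x|y is the product x * y. *)
Notation Hbar A := (talg (tens A)).

Section DoubleTensorAlgebra.
Context {k : fieldType} {A : lmodType k}.
Local Notation Hb := (Hbar A).
Local Notation HH := (tprod Hb Hb).

Definition inj_tens (x : tens A) : Hb := word [:: x].

Definition counit : Hb -> k := talg_counit.

(* H is the span of the w_1|...|w_m with m > 0, that is, the augmentation
   ideal of Hbar. *)
Definition H_set : set Hb := [set x | counit x = 0]%classic.

(* The element a_1...a_n of T(A), seen in Hbar; the empty word is 1. *)
Definition bword (a : seq A) : Hb :=
  if nilp a then 1 else inj_tens (word a).

Definition indicator (n : nat) (S : {set 'I_n}) : bitseq :=
  [seq i \in S | i <- enum 'I_n].

(* The factors of the word a, from left to right, obtained by deleting the
   letters at the positions where m is true; some of them may be empty. *)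
Fixpoint factors (m : bitseq) (a : seq A) : seq (seq A) :=
  match m, a with
  | b :: m', x :: a' =>
      let r := factors m' a' in
      if b then [::] :: r else (x :: head [::] r) :: behead r
  | _, _ => [:: [::]]
  end.

Definition a_in (m : bitseq) (a : seq A) : Hb := bword (mask m a).

(* The non-empty factors are the restrictions of a to the maximal intervals of
   positions where m is false. *)
Definition a_out (m : bitseq) (a : seq A) : Hb :=
  \prod_(J <- factors m a | ~~ nilp J) bword J.

(* Positions are numbered from 0. *)
Definition has_first (n : nat) (S : {set 'I_n}) : bool :=
  [exists i in S, i == 0%N :> nat].

Definition cop_word (P : forall n, pred {set 'I_n}) (a : seq A) : HH :=
  \sum_(S : {set 'I_(size a)} | P _ S)
    pure (a_in (indicator S) a) (a_out (indicator S) a).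

Definition cop (P : forall n, pred {set 'I_n}) : tens A -> HH :=
  tsum_lift (cop_word P).

Definition cop_full : tens A -> HH := cop (fun=> xpredT).
Definition cop_prec : tens A -> HH := cop has_first.
Definition cop_succ : tens A -> HH := cop (fun n => predC (@has_first n)).

Lemma inj_tens_linear : linear inj_tens.
Proof. by move=> c x y; exact: (@word_multilinear _ xpredT _ c x y [::] [::]). Qed.

Lemma factors_split m1 u b m2 v : size m1 = size u ->
  if b then forall z, factors (m1 ++ b :: m2) (u ++ z :: v)
                        = factors m1 u ++ factors m2 v
  else exists P l r Q, forall z,
         factors (m1 ++ b :: m2) (u ++ z :: v) = P ++ (l ++ z :: r) :: Q.
Proof.
elim: m1 u => [|b' m1 IH] [|x u] //= => [_|[] /IH{IH}].
  case: b => // /=.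
  by exists [::], [::], (head [::] (factors m2 v)), (behead (factors m2 v)).
have fN0 : factors m1 u = head [::] (factors m1 u) :: behead (factors m1 u).
  by case: m1 u => [|? ?] [|? ?] //=; case: ifP.
case: b => [IH z|[P [l [r [Q IH]]]]].
  by rewrite IH; case: b' => //; rewrite fN0.
case: b'; first by exists ([::] :: P), l, r, Q => z; rewrite IH.
case: P IH => [|p P] IH; first by exists [::], (x :: l), r, Q => z; rewrite IH.
by exists ((x :: p) :: P), l, r, Q => z; rewrite IH.
Qed.

Lemma bword_multilinear c x y u v :
  bword (u ++ (c *: x + y) :: v) = c *: bword (u ++ x :: v) + bword (u ++ y :: v).
Proof.
have nz z : nilp (u ++ z :: v) = false by rewrite /nilp size_cat /= addnS.
by rewrite /bword !nz word_multilinear // inj_tens_linear.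
Qed.

Lemma cop_term_multilinear c x y u v m : size m = (size u + size v).+1 ->
  let F z := pure (a_in m (u ++ z :: v)) (a_out m (u ++ z :: v)) : HH in
  F (c *: x + y) = c *: F x + F y.
Proof.
move=> sm; rewrite /= /a_in.
have sz1 : size (take (size u) m) = size u.
  by rewrite size_take sm ltnS leq_addr.
have [b [m2 Em]] : exists b m2, drop (size u) m = b :: m2.
  have : size (drop (size u) m) = (size v).+1.
    by rewrite size_drop sm -addnS addKn.
  by case: drop => // b m2 _; exists b, m2.
rewrite -(cat_take_drop (size u) m) Em; have := factors_split b m2 v sz1.
rewrite /a_out !mask_cat //=; case: b {Em} => [E|[P [l [r [Q E]]]]].
  by rewrite !E /= bword_multilinear (pure_bilin.1 _).
have nz z : nilp (l ++ z :: r) = false by rewrite /nilp size_cat /= addnS.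
rewrite !E !big_cat !big_cons /= !nz /= bword_multilinear.
by rewrite mulrDl mulrDr -scalerAl -scalerAr (pure_bilin.2 _).
Qed.

Lemma cop_wordE P a n : size a = n -> cop_word P a =
  \sum_(S : {set 'I_n} | P _ S)
    pure (a_in (indicator S) a) (a_out (indicator S) a).
Proof. by move=> <-. Qed.

Lemma cop_word_multilinear P : multilinear posn (cop_word P).
Proof.
move=> c x y u v _; have sz z : size (u ++ z :: v) = (size u + size v).+1.
  by rewrite size_cat /= addnS.
rewrite !(cop_wordE P (sz _)) scaler_sumr -big_split /=.
apply: eq_bigr => S _; apply: cop_term_multilinear.
by rewrite size_map -cardE card_ord.
Qed.

Lemma cop_linear P : linear (cop P).
Proof. exact/tsum_lift_linear/cop_word_multilinear. Qed.

Lemma copE P a : (0 < size a)%N -> cop P (word a) = cop_word P a.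
Proof. exact/tsum_liftE/cop_word_multilinear. Qed.

Lemma prod_cop_multilinear (f : tens A -> HH) : linear f ->
  multilinear xpredT (fun s => \prod_(w <- s) f w).
Proof.
move=> lf c x y u v _; rewrite !big_cat !big_cons /= lf mulrDl mulrDr.
by rewrite -tprod_scaleAl -tprod_scaleAr.
Qed.

Definition Delta : Hb -> HH :=
  tsum_lift (fun s => \prod_(w <- s) cop_full w).

(* A half-coproduct is only defined on H; it is extended by 0 to 1. *)
Definition half_Delta (f : tens A -> HH) : Hb -> HH :=
  tsum_lift (fun s =>
    if s is w :: s' then f w * \prod_(v <- s') cop_full v else 0).

Definition Delta_prec_plus : Hb -> HH := half_Delta cop_prec.
Definition Delta_succ_plus : Hb -> HH := half_Delta cop_succ.

Let half_multilinear (f : tens A -> HH) : linear f ->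
  multilinear xpredT (fun s =>
    if s is w :: s' then f w * \prod_(v <- s') cop_full v else 0).
Proof.
move=> lf c x y [|w u] v _ /=; first by rewrite lf mulrDl -tprod_scaleAl.
rewrite (prod_cop_multilinear (cop_linear _)) // mulrDr.
by rewrite -tprod_scaleAr.
Qed.

Lemma Delta_linear : linear Delta.
Proof.
by apply: tsum_lift_linear; apply: prod_cop_multilinear; exact: cop_linear.
Qed.

Lemma half_Delta_linear f : linear f -> linear (half_Delta f).
Proof. by move=> lf; apply: tsum_lift_linear; exact: half_multilinear. Qed.

Lemma half_DeltaE f w s : linear f ->
  half_Delta f (word (w :: s)) = f w * \prod_(v <- s) cop_full v.
Proof. by move=> lf; rewrite /half_Delta (tsum_liftE (half_multilinear lf)). Qed.

Lemma DeltaE s : Delta (word s) = \prod_(w <- s) cop_full w.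
Proof.
by apply: tsum_liftE => //; apply: prod_cop_multilinear; exact: cop_linear.
Qed.

Definition proj_H (x : Hb) : Hb := x - counit x *: 1.

Definition Delta_prec (x : Hb) : HH := Delta_prec_plus x - pure (proj_H x) 1.
Definition Delta_succ (x : Hb) : HH := Delta_succ_plus x - pure 1 (proj_H x).

Local Notation form := (Hb -> k).
Implicit Types (f g Phi Psi alpha : form).

(* m_k o (f (x) g) *)
Definition tensor_form f g : HH -> k :=
  tprod_lift (fun x y => f x * g y : k^o).

Definition conv f g : form := fun x => tensor_form f g (Delta x).

Definition reduced f : form := fun x => f x - f 1 * counit x.

(* The half-shuffle products of forms vanishing at 1 are the first summands;
   they are extended bilinearly to all forms by e > f = f = f < e and
   e < f = 0 = f > e. The undefined values e < e and e > e are set to 0, and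
   are never used below. *)
Definition half_prec f g : form := fun x =>
  tensor_form (reduced f) (reduced g) (Delta_prec x) + g 1 * reduced f x.

Definition half_succ f g : form := fun x =>
  tensor_form (reduced f) (reduced g) (Delta_succ x) + f 1 * reduced g x.

Definition G_H : set form :=
  [set Phi | scalar Phi /\ monoid_morphism Phi]%classic.

Definition g_H : set form :=
  [set gamma : form | [/\ scalar gamma, gamma 1 = 0 &
     forall x y, H_set x -> H_set y -> gamma (x * y) = 0]]%classic.

(* The unique solutions of the half-shuffle fixed point equations; likewise
   conv_inv is the inverse for the convolution in G_H. *)
Definition E_prec alpha : form :=
  xget counit [set Phi | scalar Phi /\ Phi = counit \+ half_prec alpha Phi]%classic.

Definition E_succ alpha : form :=
  xget counit [set Phi | scalar Phi /\ Phi = counit \+ half_succ Phi alpha]%classic.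

Definition conv_inv Phi : form :=
  xget counit [set Psi | [/\ G_H Psi, conv Phi Psi = counit
                                    & conv Psi Phi = counit]]%classic.

Definition log_prec Phi : form := half_prec (Phi \- counit) (conv_inv Phi).
Definition log_succ Phi : form := half_succ (conv_inv Phi) (Phi \- counit).

Definition hpow_succ Psi (s : k) : form := E_succ (s \*o log_succ Psi).

Definition BB (t : k) Phi : form :=
  hpow_succ (E_prec ((1 + t) \*o log_prec Phi)) (1 + t)^-1.

End DoubleTensorAlgebra.


Arguments G_H {k} A.
Arguments g_H {k} A.

(* Main.v *)
Require Import Defs.
From HB Require Import structures.
From mathcomp Require Import all_boot all_order all_algebra.
From mathcomp Require Import boolp classical_sets functions reals.

Set Implicit Arguments.
Unset Strict Implicit.
Unset Printing Implicit Defensive.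

Import GRing.Theory Num.Theory.

Local Open Scope ring_scope.

(* A character Phi is determined by its restriction f to words, a noncommutative
   power series with constant term 1. Write c(f) for the series c in which every
   letter x is replaced by x f. On words, the half-shuffle fixed point equations
   Phi = e + alpha < Phi and Phi = e + Phi > alpha become f = 1 + kappa(f) and
   f = 1 + b f: their solutions kappa and b are the free and Boolean cumulant
   series of Phi. The convolution of f and g is g f(g), and substitution is an
   algebra endomorphism with (c(f))(g) = c(g f(g)).
     For M = 1 + (t b)(M), let theta_t(b) be the series c such that c M = b(M).
   If moreover N = 1 + (s c)(N), the convolution P of M and N satisfies
   P = M(N) + s c(N) M(N) = 1 + t b(P) + s (c M)(N) = 1 + (s + t) b(P), whence
   theta_s(theta_t(b)) = theta_{s+t}(b). As theta_1 maps free to Boolean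
   cumulants, BB t acts on Boolean cumulant series as theta_t, whose inverse is
   theta_{-t}. *)

(** * Noncommutative power series *)

(** A type of its own, so that the product put on it below is the Cauchy product and not the
    pointwise one. *)
Definition series (k : fieldType) (A : Type) : Type := seq A -> k^o.

HB.instance Definition _ (k : fieldType) (A : Type) :=
  GRing.Lmodule.copy (series k A) (seq A -> k^o).

Section Series.
Context {k : fieldType} {A : Type}.
Local Notation series := (series k A).
Implicit Types (f g h : series) (x : A) (a : seq A).

Lemma seriesD f g a : (f + g) a = f a + g a. Proof. by []. Qed.
Lemma seriesB f g a : (f - g) a = f a - g a. Proof. by []. Qed.
Lemma seriesZ (c : k) f a : (c *: f) a = c * f a. Proof. by []. Qed.

(** The left derivative. A series is determined by its constant term and its left derivatives,
    through which most inductions below proceed. *)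
Definition der x f : series := fun a => f (x :: a).

Definition series_one : series := fun a => (nilp a)%:R.

(** The sum of [f u * g v] over all factorisations [a = u v]; the recursion sets apart the one with
    [u] empty. *)
Fixpoint series_mul f g a {struct a} : k^o :=
  match a with
  | [::] => f [::] * g [::]
  | x :: a' => f [::] * g a + series_mul (der x f) g a'
  end.

Lemma series_mul_linearl g (c : k) f f' :
  series_mul (c *: f + f') g = c *: series_mul f g + series_mul f' g.
Proof.
apply/funext => a; elim: a f f' => [|x a IH] f f' /=.
  by rewrite mulrDl -mulrA.
rewrite (IH (der x f)) !seriesD !seriesZ /= mulrDl mulrDr addrACA -mulrA.
by congr (_ + _ + _).
Qed.

Lemma series_mul_linearr f (c : k) g g' :
  series_mul f (c *: g + g') = c *: series_mul f g + series_mul f g'.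
Proof.
apply/funext => a; elim: a f => [|x a IH] f /=.
  by rewrite mulrDr mulrCA.
by rewrite IH !seriesD !seriesZ /= !mulrDr mulrCA addrACA.
Qed.

Lemma series_mul0 g : series_mul 0 g = 0.
Proof.
by have := series_mul_linearl g (-1) 0 0; rewrite scaler0 addr0 scaleN1r addNr.
Qed.

Lemma der_one x : der x series_one = 0. Proof. by []. Qed.

Lemma series_mulA : associative series_mul.
Proof.
move=> f g h; apply/funext => a; elim: a f g => [|x a IH] f g /=.
  by rewrite mulrA.
rewrite IH -[der x (series_mul f g)]/(f [::] *: der x g +
  series_mul (der x f) g).
by rewrite series_mul_linearl seriesD seriesZ mulrDr addrA mulrA.
Qed.

Lemma series_mul1 : left_id series_one series_mul.
Proof.
move=> f; apply/funext => -[|x a] /=; rewrite mul1r // der_one.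
by rewrite series_mul0 addr0.
Qed.

Lemma series_mulr1 : right_id series_one series_mul.
Proof.
move=> f; apply/funext => a; elim: a f => [|x a IH] f /=; first exact: mulr1.
by rewrite IH mulr0 add0r.
Qed.

Lemma series_mulDl : left_distributive series_mul +%R.
Proof.
by move=> f g h; have := series_mul_linearl h 1 f g; rewrite !scale1r.
Qed.

Lemma series_mulDr : right_distributive series_mul +%R.
Proof.
by move=> f g h; have := series_mul_linearr f 1 g h; rewrite !scale1r.
Qed.

HB.instance Definition _ := GRing.Zmodule_isPzRing.Build series
  series_mulA series_mul1 series_mulr1 series_mulDl series_mulDr.

Lemma series_scaleAl (c : k) f g : c *: (f * g) = (c *: f) * g.
Proof.
have := series_mul_linearl g c f 0.
by rewrite series_mul0 !addr0 => E; apply/esym.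
Qed.

Lemma series_scaleAr (c : k) f g : c *: (f * g) = f * (c *: g).
Proof.
have := series_mul_linearr f c g 0;
  rewrite [X in _ = _ + X](mulr0 (f : series)).
by rewrite !addr0 => E; apply/esym.
Qed.

Lemma seriesM0 f g : (f * g) [::] = f [::] * g [::]. Proof. by []. Qed.
Lemma series10 : (1 : series) [::] = 1. Proof. by []. Qed.

Lemma derM x f g : der x (f * g) = f [::] *: der x g + der x f * g.
Proof. by []. Qed.

(** * Contractions for the length filtration *)

Definition agree n f g := forall a, (size a < n)%N -> f a = g a.

Lemma agreeW m n f g : (m <= n)%N -> agree n f g -> agree m f g.
Proof. by move=> mn fg a am; apply: fg; exact: leq_trans mn. Qed.

Lemma agreeS n f g : f [::] = g [::] ->
  (forall x, agree n (der x f) (der x g)) -> agree n.+1 f g.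
Proof. by move=> fg0 fg [|x a] // an; exact: fg. Qed.

Lemma agree_eq f g : (forall n, agree n f g) -> f = g.
Proof. by move=> fg; apply/funext => a; exact: (fg (size a).+1). Qed.

Lemma agreeD n f f' g g' : agree n f f' -> agree n g g' ->
  agree n (f + g) (f' + g').
Proof. by move=> ff gg a an; rewrite !seriesD ff ?gg. Qed.

Lemma agreeB n f f' g g' : agree n f f' -> agree n g g' ->
  agree n (f - g) (f' - g').
Proof. by move=> ff gg a an; rewrite !seriesB ff ?gg. Qed.

Lemma agreeM n f f' g g' : agree n f f' -> agree n g g' ->
  agree n (f * g) (f' * g').
Proof.
move=> ff gg a; elim: a n f f' ff gg => [|x a IH] [|n] // f f' ff gg an.
  by rewrite !seriesM0 ff ?gg.
rewrite -[LHS]/(f [::] * g (x :: a) + (der x f * g) a).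
rewrite -[RHS]/(f' [::] * g' (x :: a) + (der x f' * g') a).
rewrite ff ?gg //; congr (_ + _); apply: (IH n) => //.
  by move=> b bn; exact: ff.
by apply: agreeW gg.
Qed.

(** As [g] has no constant term, [f] is only evaluated on proper prefixes, so one length less
    suffices for it. *)
Lemma agreeMr n f f' g g' : g [::] = 0 ->
  agree n f f' -> agree n.+1 g g' -> agree n.+1 (f * g) (f' * g').
Proof.
move=> g0 ff gg; have g'0 : g' [::] = 0 by rewrite -gg.
move=> a; elim: a n f f' ff gg => [|x a IH] n f f' ff gg an.
  by rewrite !seriesM0 g0 g'0 !mulr0.
rewrite -[LHS]/(f [::] * g (x :: a) + (der x f * g) a).
rewrite -[RHS]/(f' [::] * g' (x :: a) + (der x f' * g') a).
case: n ff gg an => [|n] ff gg an //.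
rewrite ff ?gg //; congr (_ + _); apply: (IH n) => //.
  by move=> b bn; exact: ff.
by apply: agreeW gg.
Qed.

Lemma agreeMl n f f' g g' : f [::] = 0 ->
  agree n.+1 f f' -> agree n g g' -> agree n.+1 (f * g) (f' * g').
Proof.
move=> f0 ff gg; have f'0 : f' [::] = 0 by rewrite -ff.
apply: agreeS => [|x]; first by rewrite !seriesM0 f0 f'0 !mul0r.
rewrite !derM f0 f'0 !scale0r !add0r; apply: agreeM => //.
by move=> a an; exact: ff.
Qed.

Definition contraction (T : series -> series) :=
  forall n g h, agree n g h -> agree n.+1 (T g) (T h).

(** The limit of the iterates from 0: for a contraction they are stationary on words of length [n]
    from the iterate [n + 1] on. *)
Definition series_fix (T : series -> series) : series :=
  fun a => iter (size a).+1 T 0 a.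

Lemma contraction_uniq T g h : contraction T -> g = T g -> h = T h -> g = h.
Proof.
move=> cT gT hT; apply: agree_eq; elim=> [|n IH] //.
by rewrite gT hT; exact: cT.
Qed.

Lemma series_fixE T : contraction T -> series_fix T = T (series_fix T).
Proof.
move=> cT; have step m : agree m (iter m T 0) (iter m.+1 T 0).
  by elim: m => [|m IH] //; exact: cT.
have le m n : (m <= n)%N -> agree m (iter m T 0) (iter n T 0).
  elim: n => [|n IH]; first by case: m.
  rewrite leq_eqVlt => /orP[/eqP->//|mn] a am.
  by rewrite (IH mn) // (step n) //; exact: leq_trans am mn.
apply/funext => a; rewrite {1}/series_fix iterS.
apply: (cT (size a)) => // b ba; apply/esym.
by rewrite /series_fix; exact: le.
Qed.

(** Both [f] and [g] are fixed points of [u |-> g * h - u * (h - 1)], a contraction because [h - 1]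
    has no constant term. *)
Lemma mulIr_series f g h : h [::] = 1 -> f * h = g * h -> f = g.
Proof.
move=> h1 fg; pose T u := g * h - u * (h - 1).
have cT : contraction T.
  move=> n u v uv; apply: agreeB => //; apply: agreeMr => //.
  by rewrite seriesB h1 subrr.
by apply: (contraction_uniq cT);
  rewrite /T mulrBr mulr1 ?fg opprB addrCA subrr addr0.
Qed.

Lemma series_divr f h : h [::] = 1 -> exists g, g * h = f.
Proof.
move=> h1; pose T u := f - u * (h - 1).
have cT : contraction T.
  move=> n u v uv; apply: agreeB => //; apply: agreeMr => //.
  by rewrite seriesB h1 subrr.
exists (series_fix T); move: (series_fixE cT); rewrite {2}/T mulrBr mulr1 opprB.
set g := series_fix T; rewrite addrCA => E; apply/eqP; rewrite eq_sym -subr_eq0.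
by apply/eqP/(addrI g); rewrite addr0 -E.
Qed.

End Series.

(** * Substitution of x f for every letter x *)

(** Subsets of positions coded as Boolean words, so that a sum over subsets unfolds along the first
    letter. *)
Fixpoint masks n : seq bitseq :=
  if n is n'.+1 then map (cons true) (masks n') ++ map (cons false) (masks n')
  else [:: [::]].

Lemma big_masksS (V : nmodType) n (F : bitseq -> V) :
  \sum_(m <- masks n.+1) F m =
  \sum_(m <- masks n) F (true :: m) + \sum_(m <- masks n) F (false :: m).
Proof. by rewrite /= big_cat !big_map. Qed.

Section Substitution.
Context {k : fieldType} {A : lmodType k}.
Local Notation series := (series k A).
Implicit Types (c f g h : series) (x : A) (a : seq A).

Lemma factors_cons m a :
  factors m a = head [::] (factors m a) :: behead (factors m a).
Proof. by case: m a => [|[] m] [|x a]. Qed.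

(** The kept letters are read by [c], the gap before the first of them by [h], the later gaps by
    [f]. Singling out the first gap closes the family under [der]: once the first letter is kept,
    the next gap, read by [f], becomes the first one. *)
Definition mask_sum c h f : series := fun a =>
  \sum_(m <- masks (size a)) c (mask m a) *
    (h (head [::] (factors m a)) * \prod_(J <- behead (factors m a)) f J).

Lemma mask_sum0 c h f : mask_sum c h f [::] = c [::] * h [::].
Proof. by rewrite /mask_sum big_seq1 /= big_nil mulr1. Qed.

Lemma der_mask_sum x c h f : der x (mask_sum c h f) =
  h [::] *: mask_sum (der x c) f f + mask_sum c (der x h) f.
Proof.
apply/funext => a; rewrite seriesD seriesZ /der {1}/mask_sum big_masksS.
congr (_ + _) => //=; rewrite /mask_sum mulr_sumr; apply: eq_bigr => m _.
by rewrite {1}factors_cons big_cons mulrCA.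
Qed.

(* Replaces every letter x of c by x f. *)
Definition subst c f : series := mask_sum c 1 f.

Lemma mask_sum_linear h f : linear (fun c => mask_sum c h f).
Proof.
move=> t c c'; apply/funext => a; rewrite seriesD seriesZ /mask_sum mulr_sumr.
by rewrite -big_split; apply: eq_bigr => m _;
  rewrite /= seriesD seriesZ mulrDl -mulrA.
Qed.

Lemma mask_sum0r c f : mask_sum c 0 f = 0.
Proof.
by apply/funext => a; rewrite /mask_sum big1 // => m _; rewrite mul0r mulr0.
Qed.

Lemma der_subst_mask x c f : der x (subst c f) = mask_sum (der x c) f f.
Proof.
by rewrite der_mask_sum [der x 1](der_one x) mask_sum0r addr0 series10 scale1r.
Qed.

(** The first gap is a prefix of the word, read by [h] independently of the rest, so it splits off
    as a left factor. *)
Lemma mask_sumE c h f : mask_sum c h f = h * subst c f.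
Proof.
apply/funext => a; elim: a h => [|x a IH] h.
  by rewrite mask_sum0 seriesM0 /subst mask_sum0 mulr1 mulrC.
rewrite -[LHS]/(der x (mask_sum c h f) a) -[RHS]/(der x (h * subst c f) a).
by rewrite der_mask_sum derM der_subst_mask !seriesD !seriesZ IH.
Qed.

Lemma subst_nil c f : subst c f [::] = c [::].
Proof. by rewrite /subst mask_sum0 mulr1. Qed.

Lemma der_subst x c f : der x (subst c f) = f * subst (der x c) f.
Proof. by rewrite der_subst_mask mask_sumE. Qed.

Lemma subst_linear f : linear (subst^~ f).
Proof. exact: mask_sum_linear. Qed.

Lemma subst0 f : subst 0 f = 0.
Proof.
by have := subst_linear f (-1) 0 0; rewrite scaler0 addr0 scaleN1r addNr.
Qed.

Lemma substZ t c f : subst (t *: c) f = t *: subst c f.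
Proof. by rewrite -[t *: c]addr0 subst_linear subst0 addr0. Qed.

Lemma substD c c' f : subst (c + c') f = subst c f + subst c' f.
Proof. by have := subst_linear f 1 c c'; rewrite !scale1r. Qed.

Lemma substB c c' f : subst (c - c') f = subst c f - subst c' f.
Proof. by rewrite -!scaleN1r substD substZ. Qed.

(** Every factor [f] in the substituted series is preceded by a letter, whence the gain of one
    length, whatever the constant term of [f]. *)
Lemma agree_subst n c f f' : agree n f f' ->
  agree n.+1 (subst c f) (subst c f').
Proof.
elim: n c => [|n IH] c ff; apply: agreeS => [|x]; rewrite ?subst_nil //.
rewrite !der_subst; apply: agreeM => //.
by apply: IH; apply: agreeW ff.
Qed.

Lemma subst_one f : subst 1 f = 1.
Proof.
apply/funext => -[|x a]; first exact: subst_nil.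
rewrite -[LHS]/(der x (subst 1 f) a) der_subst [der x 1](der_one x).
by rewrite subst0 mulr0.
Qed.

(** The constant terms match, and by the product rule the derivatives match once the claim holds for
    [der x c] at one length less. *)
Lemma substM c c' f : subst (c * c') f = subst c f * subst c' f.
Proof.
apply: agree_eq => n; elim: n c => [|n IH] c //.
apply: agreeS => [|x]; first by rewrite seriesM0 !subst_nil.
rewrite derM !der_subst derM substD substZ mulrDr -series_scaleAr subst_nil.
by apply: agreeD => //; rewrite -mulrA; apply: agreeM.
Qed.

Lemma subst1 c : subst c 1 = c.
Proof.
apply: agree_eq => n; elim: n c => [|n IH] c //.
apply: agreeS => [|x]; first exact: subst_nil.
by rewrite der_subst mul1r.
Qed.

(* The restriction to words of the convolution of two characters that restrict
   to f and g. *)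
Definition conv_series f g : series := g * subst f g.

Lemma substA c f g : subst (subst c f) g = subst c (conv_series f g).
Proof.
apply: agree_eq => n; elim: n c => [|n IH] c //.
apply: agreeS => [|x]; first by rewrite !subst_nil.
by rewrite !der_subst substM mulrA; apply: agreeM.
Qed.

Lemma conv_series_nil f g : conv_series f g [::] = g [::] * f [::].
Proof. by rewrite /conv_series seriesM0 subst_nil. Qed.

Lemma conv_seriesA f g h :
  conv_series (conv_series f g) h = conv_series f (conv_series g h).
Proof. by rewrite {1 2}/conv_series substM substA mulrA. Qed.

(** * Multilinear series: those that descend to linear forms on tensor powers *)

Definition multilin f := multilinear posn f.

Lemma multilinD f g : multilin f -> multilin g -> multilin (f + g).
Proof.
move=> lf lg t x y u v _; rewrite !seriesD lf ?lg //.
by rewrite scalerDr addrACA.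
Qed.

Lemma multilinZ (t : k) f : multilin f -> multilin (t *: f).
Proof.
move=> lf s x y u v _; rewrite !seriesZ lf // mulrDr; congr (_ + _).
exact: mulrCA.
Qed.

Lemma multilin1 : multilin 1.
Proof.
have nz u (z : A) v : (1 : series) (u ++ z :: v) = 0.
  by case: u.
by move=> t x y u v _; rewrite !nz scaler0 addr0.
Qed.

Lemma multilin0 : multilin 0.
Proof. by move=> t x y u v _; rewrite scaler0 addr0. Qed.

Lemma multilinB f g : multilin f -> multilin g -> multilin (f - g).
Proof.
by move=> lf lg; rewrite -scaleN1r; apply: multilinD => //; apply: multilinZ.
Qed.

Lemma multilin_der x f : multilin f -> multilin (der x f).
Proof. by move=> lf t y z u v _; exact: (lf t y z (x :: u) v). Qed.

Lemma der_linear f (t : k) x y : multilin f ->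
  der (t *: x + y) f = t *: der x f + der y f.
Proof. by move=> lf; apply/funext => a; exact: (lf t x y [::] a). Qed.

Lemma multilinM f g : multilin f -> multilin g -> multilin (f * g).
Proof.
move=> lf lg t x y u v _; elim: u f lf => [|z u IH] f lf.
  rewrite /= -![(f * g) (_ :: v)]/(der _ (f * g) v) !derM !der_linear // mulrDl.
  by rewrite -series_scaleAl scaler_exchange.
rewrite /= -![(f * g) (_ :: _)]/(der _ (f * g) _) !derM !seriesD.
rewrite IH; last exact: multilin_der.
rewrite !seriesZ (multilin_der z lg) //.
rewrite scalerDr addrACA mulrDr; congr (_ + _ + _).
exact: mulrCA.
Qed.

Lemma multilin_mask_sum c h f : multilin c -> multilin h -> multilin f ->
  multilin (mask_sum c h f).
Proof.
move=> lc lh lf t x y u v _; elim: u c h lc lh => [|z u IH] c h lc lh.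
  rewrite /= -![mask_sum c h f (_ :: v)]/(der _ (mask_sum c h f) v).
  rewrite !der_mask_sum !der_linear // mask_sum_linear.
  rewrite [in X in _ + X]mask_sumE mulrDl -series_scaleAl -!mask_sumE.
  by rewrite scaler_exchange.
rewrite /= -![mask_sum c h f (_ :: _)]/(der _ (mask_sum c h f) _).
rewrite !der_mask_sum !seriesD !seriesZ !IH //; do 2?exact: multilin_der.
rewrite scalerDr mulrDr addrACA; congr (_ + _ + _).
exact: mulrCA.
Qed.

Lemma multilin_subst c f : multilin c -> multilin f -> multilin (subst c f).
Proof. by move=> lc lf; apply: multilin_mask_sum => //; exact: multilin1. Qed.

(** The iterates from 0 are multilinear, and the one that gives the value at a word depends only on
    its length, hence is common to the three words compared. *)
Lemma multilin_fix (T : series -> series) g :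
  (forall f, multilin f -> multilin (T f)) -> contraction T -> g = T g ->
  multilin g.
Proof.
move=> lT cT /(contraction_uniq cT)/(_ (series_fixE cT))-> t x y u v _.
have sz z : size (u ++ z :: v) = (size u +
  size v).+1 by rewrite size_cat /= addnS.
rewrite /series_fix !sz.
have L n : multilin (iter n T 0).
  by elim: n => [|n IH]; [exact: multilin0 | exact: lT].
exact: L.
Qed.

(** The quotient is the fixed point of a contraction in which it enters only through the multilinear
    series [g * h]. *)
Lemma multilin_div g h : h [::] = 1 -> multilin h -> multilin (g * h) ->
  multilin g.
Proof.
move=> h1 lh lgh; apply: (@multilin_fix (fun u => g * h - u * (h - 1))).
- move=> f lf; apply: multilinB => //; apply: multilinM => //.
  by apply: multilinB => //; exact: multilin1.
- move=> n u v uv; apply: agreeB => //; apply: agreeMr => //.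
  by rewrite seriesB h1 subrr.
- by rewrite mulrBr mulr1 opprB addrCA subrr addr0.
Qed.

Lemma conv_series_inv f : f [::] = 1 -> multilin f ->
  exists g, [/\ g [::] = 1, multilin g, conv_series f g =
    1 & conv_series g f = 1].
Proof.
have inv_r (u : series) : u [::] = 1 -> multilin u ->
    exists g, [/\ g [::] = 1, multilin g & conv_series u g = 1].
  (* A fixed point satisfies [g * subst u g = 1]. The map is a contraction because [subst (u - 1) g]
     has no constant term and gains a length over [g]. *)
  move=> u1 lu; pose T g := 1 - g * subst (u - 1) g.
  have cT : contraction T.
    move=> n g h gh; apply: agreeB => //; apply: agreeMr => //.
      by rewrite subst_nil seriesB u1 subrr.
    exact: agree_subst.
  have E := series_fixE cT; exists (series_fix T); split.
  - by rewrite E /T seriesB seriesM0 subst_nil seriesB u1 subrr mulr0 subr0.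
  - apply: multilin_fix E => // g lg; apply: multilinB; first exact: multilin1.
    apply: multilinM => //; apply: multilin_subst => //.
    by apply: multilinB => //; exact: multilin1.
  - move: E; set g := series_fix T; rewrite /T substB subst_one mulrBr mulr1.
    rewrite opprB addrCA => E; apply/eqP; rewrite eq_sym -subr_eq0.
    by apply/eqP/(addrI g); rewrite addr0 -E.
(* The right inverse [g] has in turn a right inverse, which equals [f] by associativity. *)
move=> f1 lf; have [g [g1 lg fg]] := inv_r f f1 lf.
have [h [_ _ gh]] := inv_r g g1 lg; exists g; split => //.
suff -> : f = h by [].
have := conv_seriesA f g h; rewrite fg gh {1}/conv_series subst_one mulr1.
by rewrite /conv_series subst1 mul1r.
Qed.

(* bn_rel t b c holds when c is the Boolean cumulant series of BB t Phi, for Phi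
   with Boolean cumulant series b. In shuffle notation, c = M^{-1} > b < M where
   M has free cumulants t b; then M has Boolean cumulants t c. *)
Definition bn_rel (t : k) b c :=
  exists2 M, M = 1 + subst (t *: b) M & c * M = subst b M.

Lemma free_contraction (b : series) : contraction (fun M => 1 + subst b M).
Proof. by move=> n f g fg; apply: agreeD => //; exact: agree_subst. Qed.

Lemma free_nil b M : b [::] = 0 -> M = 1 + subst b M -> M [::] = 1.
Proof. by move=> b0 ->; rewrite seriesD subst_nil b0 addr0. Qed.

Lemma multilin_free b M : multilin b -> M = 1 + subst b M -> multilin M.
Proof.
move=> lb; apply: multilin_fix (free_contraction b) => f lf.
by apply: multilinD; [exact: multilin1 | exact: multilin_subst].
Qed.

Lemma bn_rel_nil t b c : b [::] = 0 -> bn_rel t b c -> c [::] = 0.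
Proof.
move=> b0 [M EM /(congr1 (fun f => f [::]))]; rewrite seriesM0 subst_nil b0.
by rewrite (free_nil _ EM) ?mulr1 // seriesZ b0 mulr0.
Qed.

Lemma bn_rel_total t b : b [::] = 0 -> exists c, bn_rel t b c.
Proof.
move=> b0; pose M := series_fix (fun M => 1 + subst (t *: b) M).
have EM : M = 1 + subst (t *: b) M := series_fixE (free_contraction _).
have M1 : M [::] = 1 by rewrite (free_nil _ EM) // seriesZ b0 mulr0.
by have [c Ec] := series_divr (subst b M) M1; exists c, M.
Qed.

Lemma bn_rel_fun t b c c' : b [::] = 0 -> bn_rel t b c -> bn_rel t b c' ->
  c = c'.
Proof.
move=> b0 [M EM Ec] [M' EM' Ec'].
rewrite (contraction_uniq (free_contraction _) EM' EM) in Ec'.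
apply: (@mulIr_series _ _ _ _ M); last by rewrite Ec Ec'.
by rewrite (free_nil _ EM) // seriesZ b0 mulr0.
Qed.

Lemma bn_rel_multilin t b c : b [::] = 0 -> multilin b -> bn_rel t b c ->
  multilin c.
Proof.
move=> b0 lb [M EM Ec]; have lM : multilin M.
  by apply: multilin_free EM; exact: multilinZ.
apply: (multilin_div _ lM); last by rewrite Ec; exact: multilin_subst.
by rewrite (free_nil _ EM) // seriesZ b0 mulr0.
Qed.

Lemma bn_rel0 b : bn_rel 0 b b.
Proof. by exists 1; rewrite ?scale0r ?subst0 ?addr0 // mulr1 subst1. Qed.

(** The equation of [M] only sees the product of time and series, and the equation of [c] is
    homogeneous. *)
Lemma bn_rel_scale s t b c : s != 0 -> bn_rel t (s *: b) (s *: c) ->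
  bn_rel (t * s) b c.
Proof.
move=> s0 [M]; rewrite scalerA => EM Ec; exists M => //.
apply: (scalerI s0); rewrite series_scaleAl Ec; exact: substZ.
Qed.

(* If M has free cumulants s b and N has free cumulants t c, where c M is the
   substitution of M in b, then conv_series M N has free cumulants (t + s) b. *)
Lemma bn_rel_comp s t b c d : bn_rel s b c -> bn_rel t c d ->
  bn_rel (t + s) b d.
Proof.
move=> [M EM Ec] [N EN Ed].
have ESM : subst M N = 1 + s *: subst b (conv_series M N).
  by rewrite {1}EM substD subst_one !substZ substA.
exists (conv_series M N).
  rewrite {1}/conv_series {1}EN mulrDl mul1r substZ -series_scaleAl -substM Ec
    substA.
  by rewrite ESM substZ scalerDl -addrA [X in _ = _ + X]addrC.
by rewrite /conv_series mulrA Ed -substM Ec substA.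
Qed.

(** Time 1 leads from free to Boolean cumulants: the series [f] itself serves as [M]. *)
Lemma bn_rel_boolean b c f : f = 1 + subst b f -> f = 1 + c * f -> bn_rel 1 b c.
Proof.
by move=> Eb Ec; exists f; rewrite ?scale1r //; apply: (addrI 1);
  rewrite -Eb -Ec.
Qed.

End Substitution.

(** * Linear forms on bar-words *)

Lemma mem_masks n m : (m \in masks n) = (size m == n).
Proof.
elim: n m => [|n IH] [|b m] //=; rewrite mem_cat.
  by apply/negP => /orP[] /mapP[].
rewrite eqSS -IH; apply/orP/idP => [[] /mapP[m' m'n [_ ->]]//|mn].
by case: b; [left|right]; apply: map_f.
Qed.

Lemma size_masksE n : size (masks n) = (2 ^ n)%N.
Proof.
by elim: n => //= n IH; rewrite size_cat !size_map IH expnS mul2n addnn.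
Qed.

Lemma indicator_inj n : injective (@indicator n).
Proof.
move=> S T /eq_in_map ST; apply/setP => i; apply: ST.
by rewrite mem_enum.
Qed.

(** Distinct subsets have distinct indicators, and there are [2 ^ n] subsets as well as masks. *)
Lemma perm_masks n : perm_eq [seq indicator B | B <- enum {set 'I_n}] (masks n).
Proof.
have u : uniq [seq indicator B | B <- enum {set 'I_n}].
  by rewrite map_inj_uniq ?enum_uniq //; exact: indicator_inj.
have sub : {subset [seq indicator B | B <- enum {set 'I_n}] <= masks n}.
  move=> _ /mapP[S _ ->]; rewrite mem_masks size_map -cardE.
  by rewrite card_ord.
have sz : (size (masks n) <= size [seq indicator B | B <- enum {set 'I_n}])%N.
  by rewrite size_masksE size_map -cardE -cardsT -powersetT card_powerset cardsT
    card_ord.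
apply: uniq_perm; [by []|exact: leq_size_uniq sz|].
exact: (uniq_min_size u sub sz).2.
Qed.

Lemma has_firstE n (S : {set 'I_n}) : has_first S = head false (indicator S).
Proof.
rewrite /has_first /indicator; case: n S => [|n] S.
  by rewrite enum_ord0; apply/existsP => -[[]].
rewrite enum_ordSl /=; apply/exists_inP/idP => [[i iS /eqP i0]|S0].
  by rewrite (_ : ord0 = i) //; apply: val_inj.
by exists ord0.
Qed.

Lemma sum_indicator (V : nmodType) n (P : pred bitseq) (F : bitseq -> V) :
  \sum_(S : {set 'I_n} | P (indicator S)) F (indicator S) =
  \sum_(m <- masks n | P m) F m.
Proof. by rewrite -(perm_big _ (perm_masks n)) big_map big_enum_cond. Qed.

Section Bridge.
Context {k : fieldType} {A : lmodType k}.
Local Notation Hb := (Hbar A).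
Local Notation HH := (tprod Hb Hb).
Local Notation form := (Hb -> k).
Implicit Types (F G Phi Psi alpha : form) (x y z : Hb) (a : seq A) (ss : seq
  (seq A)).

Definition bar ss : Hb := \prod_(a <- ss) bword a.
Definition nonnil ss := all (fun a => ~~ nilp a) ss.

Lemma bar_cons a ss : bar (a :: ss) = bword a * bar ss.
Proof. by rewrite /bar big_cons. Qed.

Lemma bar_nil : bar [::] = 1. Proof. by rewrite /bar big_nil. Qed.

Lemma bar_cat ss ss' : bar (ss ++ ss') = bar ss * bar ss'.
Proof. by rewrite /bar big_cat. Qed.

Lemma bar_filter ss : bar [seq a <- ss | ~~ nilp a] = bar ss.
Proof.
by elim: ss => //= -[|x a] ss IH /=; rewrite !bar_cons IH ?mul1r.
Qed.

Lemma bwordE a : a != [::] -> bword a = inj_tens (word a).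
Proof. by case: a. Qed.

Lemma inj_tens_mul (w : tens A) (s : seq (tens A)) :
  (word (w :: s) : Hb) = inj_tens w * word s.
Proof. by rewrite /inj_tens -[RHS]/(talg_mul _ _) talg_mulE. Qed.

Lemma bar_word ss : nonnil ss -> bar ss = word [seq word a | a <- ss].
Proof.
elim: ss => [|a ss IH] /= => [_|/andP[a0 /IH E]]; first exact: bar_nil.
rewrite bar_cons E inj_tens_mul; congr (_ * _).
by rewrite bwordE //; move: a0; case: (a).
Qed.

Lemma Hb_ext (N : lmodType k) (f g : Hb -> N) : linear f -> linear g ->
  (forall ss, nonnil ss -> f (bar ss) = g (bar ss)) -> f =1 g.
Proof.
move=> lf lg fg; apply: tsum_ext => // s _.
(* The factors in T(A) are expanded into pure words one at a time, and the expanded ones accumulate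
   in the prefix [ss]. *)
suff H ss : nonnil ss -> f (bar ss * word s) = g (bar ss * word s).
  by have := H [::] isT; rewrite bar_nil !mul1r.
elim: s ss => [|w s IH] ss ss0; first by rewrite mulr1 fg.
rewrite inj_tens_mul !mulrA; move: w.
have lin h : linear h -> linear (fun w => h (bar ss * inj_tens w * word s) : N).
  move=> lh c u v; rewrite inj_tens_linear mulrDr mulrDl -scalerAr -scalerAl.
  exact: lh.
apply: tsum_ext; [exact: lin | exact: lin | case=> // x a _].
have -> : inj_tens (word (x :: a)) = bar [:: x :: a].
  by rewrite bar_cons bar_nil mulr1.
by rewrite -bar_cat; apply: IH; rewrite /nonnil all_cat; apply/andP; split.
Qed.

Lemma tensor_form_bilin F G : scalar F -> scalar G ->
  bilin (fun x y => F x * G y : k^o).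
Proof.
move=> lF lG; split=> [y c x x'|x c y y'] /=.
  by rewrite lF mulrDl -mulrA.
rewrite lG mulrDr; congr (_ + _); exact: mulrCA.
Qed.

Lemma tensor_form_scalar F G : scalar F -> scalar G -> scalar (tensor_form F G).
Proof.
by move=> lF lG; exact: (tprod_lift_linear (tensor_form_bilin lF lG)).
Qed.

Lemma tensor_formE F G x y : scalar F -> scalar G ->
  tensor_form F G (pure x y) = F x * G y.
Proof. by move=> lF lG; exact: (tprod_liftE (tensor_form_bilin lF lG)). Qed.

Lemma scalar_mull F x : scalar F -> scalar (fun x' => F (x * x')).
Proof. by move=> lF c u v; rewrite mulrDr -scalerAr lF. Qed.

Lemma tensor_form_sum F G (I : Type) (r : seq I) (P : pred I) (E : I -> HH) :
  scalar F -> scalar G ->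
  tensor_form F G (\sum_(i <- r | P i) E i) =
  \sum_(i <- r | P i) tensor_form F G (E i).
Proof.
move=> lF lG; have l := tensor_form_scalar lF lG.
pose L : {linear HH -> k^o} := HB.pack (tensor_form F G) (GRing.isLinear.Build _
  _ _ _ (tensor_form F G) l).
exact: (linear_sum L).
Qed.

Lemma tensor_formM F G x y (Z : HH) : scalar F -> scalar G ->
  tensor_form F G (pure x y * Z) =
  tensor_form (fun x' => F (x * x')) (fun y' => G (y * y')) Z.
Proof.
move=> lF lG; have lFx := scalar_mull x lF; have lGy := scalar_mull y lG.
apply: (@tprod_ext _ _ _ k^o (fun Z => tensor_form F G (pure x y * Z))).
- by move=> c u v; rewrite mulrDr -tprod_scaleAr; exact: tensor_form_scalar.
- exact: tensor_form_scalar.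
- move=> u v; rewrite -[pure x y * pure u v]/(tprod_mul _ _) tprod_mulE.
  by rewrite !tensor_formE.
Qed.

Lemma tensor_formZl (t : k) F G (Z : HH) : scalar F -> scalar G ->
  tensor_form (fun x => t * F x) G Z = t * tensor_form F G Z.
Proof.
move=> lF lG; have ltF : scalar (fun x => t * F x).
  by move=> c u v; rewrite lF mulrDr mulrCA.
apply: (@tprod_ext _ _ _ k^o _ (fun Z => t * tensor_form F G Z)).
- exact: tensor_form_scalar.
- move=> c u v; rewrite tensor_form_scalar // mulrDr; congr (_ + _);
  exact: mulrCA.
- by move=> u v; rewrite !tensor_formE // mulrA.
Qed.

Lemma tensor_formZr (t : k) F G (Z : HH) : scalar F -> scalar G ->
  tensor_form F (fun x => t * G x) Z = t * tensor_form F G Z.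
Proof.
move=> lF lG; have ltG : scalar (fun x => t * G x).
  by move=> c u v; rewrite lG mulrDr mulrCA.
apply: (@tprod_ext _ _ _ k^o _ (fun Z => t * tensor_form F G Z)).
- exact: tensor_form_scalar.
- move=> c u v; rewrite tensor_form_scalar // mulrDr; congr (_ + _);
  exact: mulrCA.
- by move=> u v; rewrite !tensor_formE // mulrCA.
Qed.

End Bridge.

(** * Coproducts of bar-words and the counit *)

Section Coproducts.
Context {k : fieldType} {A : lmodType k}.
Local Notation Hb := (Hbar A).
Local Notation HH := (tprod Hb Hb).
Local Notation form := (Hb -> k).
Implicit Types (F G Phi Psi alpha : form) (x y z : Hb) (b : A) (a : seq A).
Implicit Types (ss : seq (seq A)).

Lemma a_outE m a : a_out m a = bar (factors m a).
Proof. by rewrite -bar_filter /bar big_filter. Qed.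

Lemma counit_scalar : scalar (counit : form).
Proof. exact: talg_counit_scalar. Qed.

Lemma counit1 : counit (1 : Hb) = 1.
Proof. exact: (talg_counitE [::]). Qed.

Lemma counitM x y : counit (x * y) = counit x * counit y.
Proof.
have ls := counit_scalar.
move: x; apply: (@tsum_ext _ _ _ k^o (fun x => counit ((x : Hb) * y)) (fun x =>
  counit x * counit y)).
- by move=> c u v; rewrite mulrDl -scalerAl ls.
- by move=> c u v; rewrite ls mulrDl -mulrA.
move=> u _; move: y.
apply: (@tsum_ext _ _ _ k^o (fun y => counit ((word u : Hb) * y)) (fun y =>
  counit (word u : Hb) * counit y)).
- by move=> c v w; rewrite mulrDr -scalerAr ls.
- by move=> c v w; rewrite ls mulrDr; congr (_ + _); exact: mulrCA.
move=> v _; rewrite -[LHS]/(counit (talg_mul (word u) (word v))).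
rewrite talg_mulE /counit !talg_counitE.
by rewrite -natrM mulnb; case: u.
Qed.

Lemma counit_bword a : counit (bword a) = (nilp a)%:R.
Proof.
by case: a => [|b a]; [exact: counit1 | exact: (talg_counitE [:: _])].
Qed.

Definition ser F : series k A := fun a => F (bword a).

Lemma ser_counit : ser counit = 1.
Proof. by apply/funext => a; exact: counit_bword. Qed.

Lemma form0 (V : lmodType k) (F : V -> k) : scalar F -> F 0 = 0.
Proof.
by move=> lF; have := lF (-1) 0 0; rewrite scaler0 addr0 mulN1r addNr.
Qed.

Lemma form_subr (V : lmodType k) (F : V -> k) (x y : V) : scalar F ->
  F (x - y) = F x - F y.
Proof. by move=> lF; rewrite addrC -scaleN1r lF mulN1r addrC. Qed.

Lemma form_scaleZ (V : lmodType k) (F : V -> k) c (x : V) : scalar F ->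
  F (c *: x) = c * F x.
Proof. by move=> lF; rewrite -[c *: x]addr0 lF (form0 lF) addr0. Qed.

Lemma char_bar F ss : monoid_morphism F -> F (bar ss) = \prod_(a <- ss) ser F a.
Proof. by move=> [F1 FM]; apply: (big_morph F). Qed.

Lemma counit_monoid : monoid_morphism (counit : form).
Proof. by split; [exact: counit1 | exact: counitM]. Qed.

(** [predT] gives the full coproduct of a word; [head false] and its complement give the two
    halves. *)
Definition cop_mask (Q : pred bitseq) a : HH :=
  \sum_(m <- masks (size a) | Q m) pure (a_in m a) (a_out m a).

Lemma cop_fullE a : a != [::] -> cop_full (word a) = cop_mask predT a.
Proof.
move=> a0; rewrite /cop_full copE; last by case: a a0.
by rewrite /cop_mask -sum_indicator.
Qed.

Lemma cop_precE a : a != [::] -> cop_prec (word a) = cop_mask (head false) a.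
Proof.
move=> a0; rewrite /cop_prec copE; last by case: a a0.
rewrite /cop_mask -sum_indicator; apply: eq_bigl => B; exact: has_firstE.
Qed.

Lemma cop_succE a : a != [::] -> cop_succ (word a) =
  cop_mask (predC (head false)) a.
Proof.
move=> a0; rewrite /cop_succ copE; last by case: a a0.
rewrite /cop_mask -sum_indicator; apply: eq_bigl => B /=; congr (~~ _);
  exact: has_firstE.
Qed.

Lemma nonnil_cons a ss : nonnil (a :: ss) = (a != [::]) && nonnil ss.
Proof. by case: a. Qed.

Lemma Delta_bar_cons a ss : nonnil (a :: ss) ->
  Delta (bar (a :: ss)) = cop_mask predT a * Delta (bar ss).
Proof.
move=> n; have := n; rewrite nonnil_cons => /andP[a0 ss0].
by rewrite !bar_word // !DeltaE /= big_cons cop_fullE.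
Qed.

Lemma Delta1 : Delta (1 : Hb) = 1.
Proof. by rewrite -[1]/(word [::]) DeltaE big_nil. Qed.

Lemma Delta_prec_plus_linear : linear (Delta_prec_plus : Hb -> HH).
Proof. exact/half_Delta_linear/cop_linear. Qed.

Lemma Delta_succ_plus_linear : linear (Delta_succ_plus : Hb -> HH).
Proof. exact/half_Delta_linear/cop_linear. Qed.

Lemma Delta_prec_plus_bar a ss : nonnil (a :: ss) ->
  Delta_prec_plus (bar (a :: ss)) = cop_mask (head false) a * Delta (bar ss).
Proof.
move=> n; have := n; rewrite nonnil_cons => /andP[a0 ss0].
rewrite !bar_word //= /Delta_prec_plus half_DeltaE; last exact: cop_linear.
by rewrite DeltaE cop_precE.
Qed.

Lemma Delta_succ_plus_bar a ss : nonnil (a :: ss) ->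
  Delta_succ_plus (bar (a :: ss)) =
    cop_mask (predC (head false)) a * Delta (bar ss).
Proof.
move=> n; have := n; rewrite nonnil_cons => /andP[a0 ss0].
rewrite !bar_word //= /Delta_succ_plus half_DeltaE; last exact: cop_linear.
by rewrite DeltaE cop_succE.
Qed.

Lemma half_multilinear (f : tens A -> HH) : linear f ->
  multilinear xpredT (fun s =>
    if s is w :: s' then f w * \prod_(v <- s') cop_full v else 0).
Proof.
move=> lf c x y [|w u] v _ /=; first by rewrite lf mulrDl -tprod_scaleAl.
rewrite (prod_cop_multilinear (cop_linear _)) // mulrDr.
by rewrite -tprod_scaleAr.
Qed.

Lemma half_Delta1 (f : tens A -> HH) : linear f -> half_Delta f 1 = 0.
Proof.
by move=> lf; rewrite /half_Delta (tsum_liftE (half_multilinear lf)).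
Qed.

Lemma Delta_prec_plus1 : Delta_prec_plus (1 : Hb) = 0.
Proof. exact/half_Delta1/cop_linear. Qed.

Lemma Delta_succ_plus1 : Delta_succ_plus (1 : Hb) = 0.
Proof. exact/half_Delta1/cop_linear. Qed.

Lemma big_masks_head (V : nmodType) n (E : bitseq -> V) :
  \sum_(m <- masks n.+1 | head false m) E m = \sum_(m <- masks n) E (true :: m).
Proof. by rewrite /= big_cat !big_map /= big_pred0_eq addr0. Qed.

Lemma big_masks_headN (V : nmodType) n (E : bitseq -> V) :
  \sum_(m <- masks n.+1 | predC (head false) m) E m =
  \sum_(m <- masks n) E (false :: m).
Proof. by rewrite /= big_cat !big_map /= big_pred0_eq add0r. Qed.

Section TensorForms.
Context {F G : form} (lF : scalar F) (lG : scalar G).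

Lemma tensor_cop_mask Q a (Z : HH) : tensor_form F G (cop_mask Q a * Z) =
  \sum_(m <- masks (size a) | Q m)
    tensor_form (fun x => F (bword (mask m a) * x))
                (fun y => G (bar (factors m a) * y)) Z.
Proof.
rewrite mulr_suml tensor_form_sum //; apply: eq_bigr => m _.
by rewrite tensor_formM // a_outE.
Qed.

Lemma tensor_cop_prec b a (Z : HH) :
  tensor_form F G (cop_mask (head false) (b :: a) * Z) =
  \sum_(m <- masks (size a))
    tensor_form (fun x => F (bword (b :: mask m a) * x))
                (fun y => G (bar (factors m a) * y)) Z.
Proof.
rewrite tensor_cop_mask big_masks_head; apply: eq_bigr => m _ /=.
by rewrite bar_cons mul1r.
Qed.

Lemma tensor_cop_succ b a (Z : HH) :
  tensor_form F G (cop_mask (predC (head false)) (b :: a) * Z) =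
  \sum_(m <- masks (size a))
    tensor_form (fun x => F (bword (mask m a) * x))
      (fun y => G (bar ((b :: head [::] (factors m a)) :: behead (factors m a))
        * y)) Z.
Proof. by rewrite tensor_cop_mask big_masks_headN. Qed.

End TensorForms.

(** Only the mask that keeps no letter contributes, and it leaves all of [a] as a single gap. *)
Lemma sum_mask_nil a (E : seq (seq A) -> k) :
  \sum_(m <- masks (size a)) (nilp (mask m a))%:R * E (factors m a) = E [:: a].
Proof.
elim: a E => [|b a IH] E; first by rewrite big_seq1 mul1r.
rewrite big_masksS big1 ?add0r => [|m _]; last by rewrite mul0r.
exact: (IH (fun r => E ((b :: head [::] r) :: behead r))).
Qed.

(** Only the mask that keeps every letter contributes; the proof reads the sum as [subst c 1]. *)
Lemma sum_factors_nil a (c : series k A) :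
  \sum_(m <- masks (size a)) c (mask m a) * counit (bar (factors m a)) = c a.
Proof.
rewrite -[RHS]/(c a) -[in RHS](subst1 c); apply: eq_bigr => m _; congr (_ * _).
by rewrite (char_bar _ counit_monoid) factors_cons big_cons ser_counit.
Qed.

Lemma tensor_counitl G x (Z : HH) : scalar G ->
  tensor_form (fun y => counit (x * y)) G Z = counit x * tensor_form counit G Z.
Proof.
move=> lG; rewrite -tensor_formZl //; last exact: counit_scalar.
by congr (tensor_form _ _ _); apply/funext => y; exact: counitM.
Qed.

Lemma tensor_counitr F x (Z : HH) : scalar F ->
  tensor_form F (fun y => counit (x * y)) Z = counit x * tensor_form F counit Z.
Proof.
move=> lF; rewrite -tensor_formZr //; last exact: counit_scalar.
by congr (tensor_form _ _ _); apply/funext => y; exact: counitM.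
Qed.

End Coproducts.

(** * Half-shuffle products of forms *)

Section HalfShuffles.
Context {k : fieldType} {A : lmodType k}.
Local Notation Hb := (Hbar A).
Local Notation HH := (tprod Hb Hb).
Local Notation form := (Hb -> k).
Implicit Types (F G X Y Phi Psi alpha : form) (x y z : Hb) (b : A) (a : seq A).
Implicit Types (ss : seq (seq A)).

Lemma tensor_scalar_Delta F G : scalar F -> scalar G ->
  scalar (fun x => tensor_form F G (Delta x)).
Proof. by move=> lF lG c x y; rewrite Delta_linear tensor_form_scalar. Qed.

Lemma form_ext F G : scalar F -> scalar G ->
  (forall ss, nonnil ss -> F (bar ss) = G (bar ss)) -> F = G.
Proof. by move=> lF lG FG; apply/funext; exact: (@Hb_ext _ _ k^o F G). Qed.

(** One half of the counit law. [G] varies in the induction, since treating the first word turns it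
    into [G] of a product. *)
Lemma Delta_counitl G x : scalar G -> tensor_form counit G (Delta x) = G x.
Proof.
move=> lG; have ls := @counit_scalar k A; move: x.
apply: (@Hb_ext _ _ k^o) => [||ss]; [exact: tensor_scalar_Delta|by []|].
elim: ss G lG => [|a ss IH] G lG n.
  by rewrite bar_nil Delta1 [1]/(pure 1 1) tensor_formE // counit1 mul1r.
have := n; rewrite nonnil_cons => /andP[a0 ss0].
rewrite Delta_bar_cons // tensor_cop_mask //.
rewrite (eq_bigr (fun m => (nilp (mask m a))%:R * G (bar (factors m a) * bar
  ss))).
  by rewrite (sum_mask_nil a (fun r => G (bar r * bar ss))) -bar_cat.
move=> m _; have lG' := scalar_mull (bar (factors m a)) lG.
by rewrite tensor_counitl // IH // counit_bword.
Qed.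

Lemma Delta_counitr F x : scalar F -> tensor_form F counit (Delta x) = F x.
Proof.
move=> lF; have ls := @counit_scalar k A; move: x.
apply: (@Hb_ext _ _ k^o) => [||ss]; [exact: tensor_scalar_Delta|by []|].
elim: ss F lF => [|a ss IH] F lF n.
  by rewrite bar_nil Delta1 [1]/(pure 1 1) tensor_formE // counit1 mulr1.
have := n; rewrite nonnil_cons => /andP[a0 ss0].
rewrite Delta_bar_cons // tensor_cop_mask //.
rewrite (eq_bigr (fun m => F (bword (mask m a) * bar ss) * counit (bar (factors
  m a)))).
  by rewrite (sum_factors_nil a (fun u => F (bword u * bar ss))) bar_cons.
move=> m _; have lF' := scalar_mull (bword (mask m a)) lF.
by rewrite tensor_counitr // IH // mulrC.
Qed.

Lemma reducedE F : F 1 = 0 -> reduced F = F.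
Proof. by move=> F1; apply/funext => x; rewrite /reduced F1 mul0r subr0. Qed.

Lemma reduced1 F : F 1 = 1 -> reduced F = F \- counit.
Proof. by move=> F1; apply/funext => x; rewrite /reduced F1 mul1r. Qed.

Lemma scalar_sub F G : scalar F -> scalar G -> scalar (F \- G).
Proof. by move=> lF lG c x y; rewrite /= lF lG mulrBr opprD addrACA. Qed.

Lemma scalar_add F G : scalar F -> scalar G -> scalar (F \+ G).
Proof. by move=> lF lG c x y; rewrite /= lF lG mulrDr addrACA. Qed.

Lemma tensor_form_subr F G X (Z : HH) : scalar F -> scalar G -> scalar X ->
  tensor_form X (F \- G) Z = tensor_form X F Z - tensor_form X G Z.
Proof.
move=> lF lG lX; move: Z; have ltF := tensor_form_scalar lX lF.
have ltG := tensor_form_scalar lX lG; have lS := scalar_sub lF lG.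
apply: (@tprod_ext _ _ _ k^o) => [||u v]; first exact: tensor_form_scalar.
  by move=> c u v; rewrite ltF ltG scalerBr opprD addrACA.
by rewrite !tensor_formE //= mulrBr.
Qed.

Lemma tensor_form_subl F G X (Z : HH) : scalar F -> scalar G -> scalar X ->
  tensor_form (F \- G) X Z = tensor_form F X Z - tensor_form G X Z.
Proof.
move=> lF lG lX; move: Z; have ltF := tensor_form_scalar lF lX.
have ltG := tensor_form_scalar lG lX; have lS := scalar_sub lF lG.
apply: (@tprod_ext _ _ _ k^o) => [||u v]; first exact: tensor_form_scalar.
  by move=> c u v; rewrite ltF ltG scalerBr opprD addrACA.
by rewrite !tensor_formE //= mulrBl.
Qed.

(** In the first word, a counit on the right lets through only the subset of all positions. It
    contains the first one, so its term lies in this half of the coproduct. *)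
Lemma Delta_prec_counit X x : scalar X -> X 1 = 0 ->
  tensor_form X counit (Delta_prec_plus x) = X x.
Proof.
move=> lX X1; have ls := @counit_scalar k A;
  have lt := tensor_form_scalar lX ls.
move: x; apply: (@Hb_ext _ _ k^o) => //.
  by move=> c x y; rewrite Delta_prec_plus_linear lt.
case=> [|[//|b a] ss] n.
  rewrite bar_nil X1 Delta_prec_plus1; exact: (form0 lt).
rewrite Delta_prec_plus_bar // tensor_cop_prec //.
rewrite bar_cons -[RHS](sum_factors_nil a (fun u => X (bword (b :: u) * bar
  ss))).
apply: eq_bigr => m _; have lX' := scalar_mull (bword (b :: mask m a)) lX.
by rewrite tensor_counitr // Delta_counitr // mulrC.
Qed.

Lemma Delta_succ_counit Y x : scalar Y -> Y 1 = 0 ->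
  tensor_form counit Y (Delta_succ_plus x) = Y x.
Proof.
move=> lY Y1; have ls := @counit_scalar k A;
  have lt := tensor_form_scalar ls lY.
move: x; apply: (@Hb_ext _ _ k^o) => //.
  by move=> c x y; rewrite Delta_succ_plus_linear lt.
case=> [|[//|b a] ss] n.
  rewrite bar_nil Y1 Delta_succ_plus1; exact: (form0 lt).
rewrite Delta_succ_plus_bar // tensor_cop_succ // bar_cons.
pose E r := Y (bar ((b :: head [::] r) :: behead r) * bar ss).
have -> : bword (b :: a) = bar [:: b :: a] by rewrite bar_cons bar_nil mulr1.
rewrite -[RHS](sum_mask_nil a E); apply: eq_bigr => m _.
set z := bar _; have lY' := scalar_mull z lY.
by rewrite tensor_counitl // Delta_counitl // counit_bword.
Qed.

(** The convention [X < e = X] restores exactly what is lost when [Y] is replaced by [Y - e], and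
    the term subtracted in [Delta_prec] vanishes because [Y - e] is 0 at 1. *)
Lemma half_precE X Y : scalar X -> scalar Y -> X 1 = 0 -> Y 1 = 1 ->
  half_prec X Y = fun x => tensor_form X Y (Delta_prec_plus x).
Proof.
move=> lX lY X1 Y1; have ls := @counit_scalar k A; apply/funext => x.
have lS := scalar_sub lY ls; have lt := tensor_form_scalar lX lS.
rewrite /half_prec (reducedE X1) (reduced1 Y1) Y1 mul1r /Delta_prec.
rewrite form_subr // tensor_formE //= Y1 counit1 subrr mulr0 subr0.
by rewrite tensor_form_subr // Delta_prec_counit // subrK.
Qed.

Lemma half_succE X Y : scalar X -> scalar Y -> X 1 = 1 -> Y 1 = 0 ->
  half_succ X Y = fun x => tensor_form X Y (Delta_succ_plus x).
Proof.
move=> lX lY X1 Y1; have ls := @counit_scalar k A; apply/funext => x.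
have lS := scalar_sub lX ls; have lt := tensor_form_scalar lS lY.
rewrite /half_succ (reducedE Y1) (reduced1 X1) X1 mul1r /Delta_succ.
rewrite form_subr // tensor_formE //= X1 counit1 subrr mul0r subr0.
by rewrite tensor_form_subl // Delta_succ_counit // subrK.
Qed.

Lemma half_prec_scalar X Y : scalar X -> scalar Y -> X 1 = 0 -> Y 1 = 1 ->
  scalar (half_prec X Y).
Proof.
move=> lX lY X1 Y1; rewrite half_precE // => c x y.
by rewrite Delta_prec_plus_linear tensor_form_scalar.
Qed.

Lemma half_succ_scalar X Y : scalar X -> scalar Y -> X 1 = 1 -> Y 1 = 0 ->
  scalar (half_succ X Y).
Proof.
move=> lX lY X1 Y1; rewrite half_succE // => c x y.
by rewrite Delta_succ_plus_linear tensor_form_scalar.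
Qed.

Lemma reduced_scalar F : scalar F -> scalar (reduced F).
Proof.
move=> lF c x y; rewrite /reduced lF (@counit_scalar k A) mulrDr opprD mulrBr.
by rewrite addrACA (mulrCA (F 1)).
Qed.

Lemma half_prec1 X Y : scalar X -> scalar Y -> X 1 = 0 -> half_prec X Y 1 = 0.
Proof.
move=> lX lY X1; rewrite /half_prec reducedE // X1 mulr0 addr0.
have lr := reduced_scalar lY.
have lt := tensor_form_scalar lX lr.
rewrite /Delta_prec Delta_prec_plus1 form_subr // form0 // tensor_formE //.
by rewrite form_subr // form_scaleZ // X1 mulr0 subrr mul0r subrr.
Qed.

Lemma half_succ1 X Y : scalar X -> scalar Y -> Y 1 = 0 -> half_succ X Y 1 = 0.
Proof.
move=> lX lY Y1; rewrite /half_succ (reducedE Y1) Y1 mulr0 addr0.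
have lr := reduced_scalar lX.
have lt := tensor_form_scalar lr lY.
rewrite /Delta_succ Delta_succ_plus1 form_subr // form0 // tensor_formE //.
by rewrite [Y _]form_subr // form_scaleZ // Y1 mulr0 subrr mulr0 subrr.
Qed.

End HalfShuffles.

(** * Characters, fixed points and cumulants *)

Section Characters.
Context {k : fieldType} {A : lmodType k}.
Local Notation Hb := (Hbar A).
Local Notation HH := (tprod Hb Hb).
Local Notation form := (Hb -> k).
Local Notation series := (series k A).
Implicit Types (F G X Y Phi Psi alpha gamma : form) (x y z : Hb) (b : A) (a :
  seq A).
Implicit Types (ss : seq (seq A)) (f g : series).

Definition tens_form f : tens A -> k^o := tsum_lift f.

(** For multilinear [f], the character with values [f] on nonempty words; it is 1 on the empty word
    whatever [f [::]] is. *)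
Definition char_of f : form :=
  @tsum_lift _ _ _ k^o (fun s => \prod_(w <- s) tens_form f w).

Lemma char_of_multilinear f : multilin f ->
  multilinear xpredT (fun s => \prod_(w <- s) tens_form f w : k^o).
Proof.
move=> lf c x y u v _; rewrite !big_cat !big_cons /= /tens_form
  (tsum_lift_linear lf).
by rewrite mulrDl mulrDr -[_ *: tsum_lift f x]/(c * _) -mulrA; congr (_ + _);
  exact: mulrCA.
Qed.

Lemma char_of_word f s : multilin f ->
  char_of f (word s) = \prod_(w <- s) tens_form f w.
Proof.
by move=> lf; rewrite /char_of (tsum_liftE (char_of_multilinear lf)).
Qed.

Lemma char_of_scalar f : multilin f -> scalar (char_of f).
Proof. by move=> lf; exact: (tsum_lift_linear (char_of_multilinear lf)). Qed.

Lemma char_ofG f : multilin f -> G_H A (char_of f).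
Proof.
move=> lf; have ls := char_of_scalar lf; split; first exact: ls.
split; first by rewrite -[1]/(word [::]) char_of_word // big_nil.
move=> x y; move: x.
apply: (@tsum_ext _ _ _ k^o (fun x => char_of f ((x : Hb) * y)) (fun x =>
  char_of f x * char_of f y)).
- by move=> c u v; rewrite mulrDl -scalerAl ls.
- by move=> c u v; rewrite ls mulrDl -mulrA.
move=> u _; move: y.
apply: (@tsum_ext _ _ _ k^o (fun y => char_of f ((word u : Hb) * y)) (fun y =>
  char_of f (word u : Hb) * char_of f y)).
- by move=> c v w; rewrite mulrDr -scalerAr ls.
- by move=> c v w; rewrite ls mulrDr; congr (_ + _); exact: mulrCA.
move=> v _; rewrite -[LHS]/(char_of f (talg_mul (word u) (word v))).
by rewrite talg_mulE !char_of_word // big_cat.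
Qed.

Lemma ser_char_of f : multilin f -> f [::] = 1 -> ser (char_of f) = f.
Proof.
move=> lf f1; apply/funext => -[|b a].
  by rewrite f1; exact: (char_ofG lf).2.1.
by rewrite /ser bwordE // char_of_word // big_seq1 /tens_form (tsum_liftE lf).
Qed.

Lemma ser_multilin F : scalar F -> multilin (ser F).
Proof. by move=> lF c x y u v _; rewrite /ser bword_multilinear; exact: lF. Qed.

Lemma ser_nil F : ser F [::] = F 1. Proof. by []. Qed.

Lemma G_H_ext F G : G_H A F -> G_H A G -> ser F = ser G -> F = G.
Proof.
move=> [lF mF] [lG mG] FG; apply: form_ext => // ss _.
by rewrite !char_bar // FG.
Qed.

Lemma char_factors G m a : G_H A G ->
  G (bar (factors m a)) =
  ser G (head [::] (factors m a)) * \prod_(J <- behead (factors m a)) ser G J.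
Proof. by move=> [_ mG]; rewrite char_bar // factors_cons big_cons. Qed.

(** [F] reads the kept letters and [G], being multiplicative, each gap separately: this is a
    [mask_sum] whose first gap is read like the others. *)
Lemma sum_full F G a : G_H A G ->
  \sum_(m <- masks (size a)) F (bword (mask m a)) * G (bar (factors m a)) =
  conv_series (ser F) (ser G) a.
Proof.
move=> GG; rewrite /conv_series -mask_sumE; apply: eq_bigr => m _.
by rewrite char_factors.
Qed.

Lemma sum_prec F G b a : G_H A G ->
  \sum_(m <- masks (size a)) F (bword (b :: mask m a)) * G (bar (factors m a)) =
  subst (ser F) (ser G) (b :: a).
Proof.
move=> GG; rewrite -[RHS]/(der b (subst (ser F) (ser G)) a) der_subst_mask.
by apply: eq_bigr => m _; rewrite char_factors.
Qed.

(** The deleted letter [b] joins the first gap, which is therefore read by the derivative of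
    [ser G]. *)
Lemma sum_succ F G b a : G_H A G ->
  \sum_(m <- masks (size a)) F (bword (mask m a)) *
     G (bar ((b :: head [::] (factors m a)) :: behead (factors m a))) =
  (der b (ser G) * subst (ser F) (ser G)) a.
Proof.
move=> [_ mG]; rewrite -mask_sumE; apply: eq_bigr => m _.
by rewrite char_bar // big_cons.
Qed.

Lemma tensor_form_char F G x y (Z : HH) : G_H A F -> G_H A G ->
  tensor_form (fun x' => F (x * x')) (fun y' => G (y * y')) Z =
  F x * G y * tensor_form F G Z.
Proof.
move=> [lF [_ mF]] [lG [_ mG]].
rewrite (_ : (fun x' => F (x * x')) = fun x' => F x * F x');
  last by apply/funext => x'; exact: mF.
rewrite (_ : (fun y' => G (y * y')) = fun y' => G y * G y');
  last by apply/funext => y'; exact: mG.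
rewrite tensor_formZl //; first by rewrite tensor_formZr // mulrA.
by move=> c u v; rewrite lG mulrDr mulrCA.
Qed.

Lemma conv_bar F G ss : G_H A F -> G_H A G -> nonnil ss ->
  conv F G (bar ss) = \prod_(a <- ss) conv_series (ser F) (ser G) a.
Proof.
move=> FG GG; have [lF mF] := FG; have [lG mG] := GG.
elim: ss => [|a ss IH] n.
  rewrite bar_nil /conv Delta1 [1]/(pure 1 1) tensor_formE // mF.1 mG.1 mulr1.
  by rewrite big_nil.
have := n; rewrite nonnil_cons => /andP[a0 ss0].
rewrite /conv Delta_bar_cons // tensor_cop_mask // big_cons -IH // -sum_full //.
by rewrite mulr_suml; apply: eq_bigr => m _; rewrite tensor_form_char.
Qed.

Lemma conv_inv_spec Phi : G_H A Phi ->
  [/\ G_H A (conv_inv Phi), conv Phi (conv_inv Phi) = counit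
    & conv (conv_inv Phi) Phi = counit].
Proof.
move=> GP; have [lP mP] := GP; have ls := @counit_scalar k A.
have [g [g1 lg fg gf]] := @conv_series_inv _ _ (ser Phi) mP.1 (ser_multilin lP).
have Gg := char_ofG lg; have sg := ser_char_of lg g1.
suff E F G : G_H A F -> G_H A G -> conv_series (ser F) (ser G) = 1 ->
  conv F G = counit.
  pose I : set form := [set Psi | [/\ G_H A Psi, conv Phi Psi = counit
    & conv Psi Phi = counit]]%classic.
  (* The inverse series is multilinear, so it extends to a character; hence [xget] does not fall
     back on its default value. *)
  apply: (@xgetPex _ counit I); exists (char_of g); split=> //.
  - by apply: E => //; rewrite sg.
  - by apply: E => //; rewrite sg.
move=> FG GG FG1; apply: form_ext => //.
  by apply: tensor_scalar_Delta; [case: FG | case: GG].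
move=> ss n; rewrite conv_bar // FG1 (char_bar _ (@counit_monoid _ _))
  ser_counit //.
Qed.

Lemma conv_series_counit F G : G_H A F -> G_H A G -> conv F G = counit ->
  conv_series (ser F) (ser G) = 1.
Proof.
move=> FG GG E; have [lF mF] := FG; have [lG mG] := GG.
apply/funext => -[|b a]; first by rewrite conv_series_nil !ser_nil mF.1 mG.1
  mulr1.
have := @conv_bar F G [:: b :: a] FG GG isT; rewrite big_cons big_nil mulr1.
move=> C; apply: (etrans (esym C)).
by rewrite E bar_cons bar_nil mulr1; exact: counit_bword.
Qed.

(** Infinitesimal characters are derivations along the counit: once the components along 1 are split
    off, the product of the remainders is killed. *)
Lemma g_HM gamma x y : g_H A gamma ->
  gamma (x * y) = gamma x * counit y + counit x * gamma y.
Proof.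
move=> [lg g1 gM]; pose x' := x - counit x *: 1; pose y' := y - counit y *: 1.
have ls := @counit_scalar k A.
have e z : counit (z - counit z *: 1) = 0.
  by rewrite (form_subr _ _ ls) (form_scaleZ _ _ ls) counit1 mulr1 subrr.
have -> : x * y = x' * y' + (counit y *: x' + counit x *: y).
  rewrite /x' /y' mulrBr mulrBl -!scalerAl -!scalerAr mul1r mulr1.
  by rewrite addrA subrK subrK.
have := lg 1 (x' * y') (counit y *: x' + counit x *: y).
rewrite scale1r mul1r => ->; rewrite gM ?add0r ?lg; try exact: e.
by rewrite (form_scaleZ _ _ lg) (form_subr _ _ lg) (form_scaleZ _ _ lg) g1 mulr0
  subr0 mulrC.
Qed.

(** The condition on bar-words propagates to the derivation rule [M], whose right-hand side vanishes
    when both factors lie in H. *)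
Lemma g_H_intro gamma : scalar gamma -> gamma 1 = 0 ->
  (forall b a ss, nonnil ss ->
     gamma (bar ((b :: a) :: ss)) = gamma (bword (b :: a)) * counit (bar ss)) ->
  g_H A gamma.
Proof.
move=> lg g1 H; have ls := @counit_scalar k A.
have M x y : gamma (x * y) = gamma x * counit y + counit x * gamma y.
  move: x; apply: (@Hb_ext _ _ k^o (fun x => gamma (x * y))
    (fun x => gamma x * counit y + counit x * gamma y)).
  - by move=> c u v; rewrite mulrDl -scalerAl lg.
  - move=> c u v; rewrite lg ls !mulrDl -!mulrA addrACA -mulrDr; by [].
  move=> ss n; move: y; apply: (@Hb_ext _ _ k^o (fun y => gamma (bar ss * y))
    (fun y => gamma (bar ss) * counit y + counit (bar ss) * gamma y)).
  - by move=> c u v; rewrite mulrDr -scalerAr lg.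
  - move=> c u v; rewrite lg ls !mulrDr addrACA; congr (_ + _).
    by rewrite !(mulrCA _ c) -mulrDr.
  move=> ss' n'; case: ss n => [|[//|b a] ss] n.
    by rewrite bar_nil counit1 g1 mul0r add0r !mul1r.
  have ss0 : nonnil ss by move: n; rewrite nonnil_cons => /andP[].
  rewrite -bar_cat /= H; last by rewrite /nonnil all_cat; apply/andP; split.
  by rewrite bar_cat counitM mulrA -H // bar_cons counitM counit_bword !mul0r
    addr0.
by split=> // x y xH yH; rewrite M xH yH mulr0 mul0r addr0.
Qed.

Lemma g_HZ (c : k) gamma : g_H A gamma -> g_H A (c \*o gamma).
Proof.
move=> [lg g1 gM]; split=> [t x y||x y xH yH] /=.
- by rewrite lg mulrDr mulrCA.
- by rewrite g1 mulr0.
- by rewrite gM // mulr0.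
Qed.

Lemma ser_gHZ (c : k) gamma : ser (c \*o gamma) = c *: ser gamma.
Proof. by []. Qed.

Lemma ser_gamma_nil gamma : g_H A gamma -> ser gamma [::] = 0.
Proof. by case. Qed.

(** Only the first word is cut by the half-coproduct; on the others the full coproduct computes the
    convolution of [Phi] with its inverse, which is the counit. *)
Lemma log_prec_bar Phi b a ss : G_H A Phi -> nonnil ss ->
  log_prec Phi (bar ((b :: a) :: ss)) =
  subst (ser Phi) (ser (conv_inv Phi)) (b :: a) * counit (bar ss).
Proof.
move=> GP n; have [GI PI IP] := conv_inv_spec GP.
have [lP mP] := GP; have [lI mI] := GI; have ls := @counit_scalar k A.
have lX := scalar_sub lP ls.
have GC : G_H A counit by split => //; exact: counit_monoid.
rewrite /log_prec half_precE //=; last 2 first.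
- by rewrite mP.1 counit1 subrr.
- exact: mI.1.
rewrite tensor_form_subl // Delta_prec_plus_bar // !tensor_cop_prec //.
(* The subtracted [counit] contributes nothing, since the kept word starts with [b]. *)
rewrite [X in _ - X]big1 ?subr0; last first.
  by move=> m _; rewrite tensor_form_char // counit_bword !mul0r.
rewrite -sum_prec // mulr_suml; apply: eq_bigr => m _.
by rewrite tensor_form_char // -[tensor_form _ _ _]/(conv Phi (conv_inv Phi)
  (bar ss)) PI.
Qed.

Lemma log_succ_bar Phi b a ss : G_H A Phi -> nonnil ss ->
  log_succ Phi (bar ((b :: a) :: ss)) =
  (der b (ser Phi) * subst (ser (conv_inv Phi)) (ser Phi)) a * counit (bar ss).
Proof.
move=> GP n; have [GI PI IP] := conv_inv_spec GP.
have [lP mP] := GP; have [lI mI] := GI; have ls := @counit_scalar k A.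
have lX := scalar_sub lP ls.
have GC : G_H A counit by split => //; exact: counit_monoid.
rewrite /log_succ half_succE //=; last 2 first.
- exact: mI.1.
- by rewrite mP.1 counit1 subrr.
rewrite tensor_form_subr // Delta_succ_plus_bar // !tensor_cop_succ //.
rewrite [X in _ - X]big1 ?subr0; last first.
  move=> m _; rewrite tensor_form_char // bar_cons counitM counit_bword.
  by rewrite mul0r mulr0 mul0r.
rewrite -sum_succ // mulr_suml; apply: eq_bigr => m _.
by rewrite tensor_form_char // -[tensor_form _ _ _]/(conv (conv_inv Phi) Phi
  (bar ss)) IP.
Qed.

End Characters.

(** * Half-shuffle logarithms and exponentials as series *)

Section FixedPoints.
Context {k : fieldType} {A : lmodType k}.
Local Notation Hb := (Hbar A).
Local Notation form := (Hb -> k).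
Local Notation series := (series k A).
Implicit Types (F G X Y Phi Psi alpha gamma : form) (x y z : Hb) (b : A) (a :
  seq A).
Implicit Types (ss : seq (seq A)) (f g : series).

(** On words the logarithm is [f - 1] with [g] substituted, for [f] and [g] the series of [Phi] and
    its inverse. Substituting [f] undoes this, [g] and [f] being inverse for convolution. *)
Lemma log_precP Phi : G_H A Phi -> g_H A (log_prec Phi) /\
  ser Phi = 1 + subst (ser (log_prec Phi)) (ser Phi).
Proof.
move=> GP; have [GI PI IP] := conv_inv_spec GP.
have [lP mP] := GP; have [lI mI] := GI; have ls := @counit_scalar k A.
have lX := scalar_sub lP ls; have X1 : (Phi \- counit) 1 = 0.
  by rewrite /= mP.1 counit1 subrr.
have L1 : log_prec Phi 1 = 0 by rewrite /log_prec half_prec1.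
have Lc b a : log_prec Phi (bword (b :: a)) =
    subst (ser Phi) (ser (conv_inv Phi)) (b :: a).
  have := @log_prec_bar _ _ Phi b a [::] GP isT.
  by rewrite bar_cons bar_nil counit1 !mulr1.
have L : ser (log_prec Phi) = subst (ser Phi - 1) (ser (conv_inv Phi)).
  apply/funext => -[|b a].
    by rewrite subst_nil seriesB !ser_nil L1 mP.1 subrr.
  by rewrite /ser Lc substB subst_one seriesB subr0.
split.
  apply: g_H_intro => // [|b a ss n]; last by rewrite log_prec_bar // Lc.
  by apply: half_prec_scalar => //; exact: mI.1.
rewrite L substA (conv_series_counit GI GP IP) subst1.
by rewrite addrC subrK.
Qed.

(** Substituting [ser Phi] in the series of the inverse gives the multiplicative inverse of
    [ser Phi], so each derivative of the logarithm is a derivative of [ser Phi] divided on the right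
    by [ser Phi]. *)
Lemma log_succP Phi : G_H A Phi -> g_H A (log_succ Phi) /\
  ser Phi = 1 + ser (log_succ Phi) * ser Phi.
Proof.
move=> GP; have [GI PI IP] := conv_inv_spec GP.
have [lP mP] := GP; have [lI mI] := GI; have ls := @counit_scalar k A.
have lX := scalar_sub lP ls; have X1 : (Phi \- counit) 1 = 0.
  by rewrite /= mP.1 counit1 subrr.
have L1 : log_succ Phi 1 = 0 by rewrite /log_succ half_succ1.
have Lc b a : log_succ Phi (bword (b :: a)) =
    (der b (ser Phi) * subst (ser (conv_inv Phi)) (ser Phi)) a.
  have := @log_succ_bar _ _ Phi b a [::] GP isT.
  by rewrite bar_cons bar_nil counit1 !mulr1.
split.
  apply: g_H_intro => // [|b a ss n]; last by rewrite log_succ_bar // Lc.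
  by apply: half_succ_scalar => //; exact: mI.1.
have Pq : ser Phi * subst (ser (conv_inv Phi)) (ser Phi) = 1.
  exact: conv_series_counit GI GP IP.
(* Convolution yields a right inverse of [ser Phi]; the existence of a left inverse makes it
   two-sided. *)
have [g gP] := @series_divr _ _ 1 (ser Phi) mP.1.
have qP : subst (ser (conv_inv Phi)) (ser Phi) * ser Phi = 1.
  by rewrite -[X in X * _]mul1r -{1}gP -[g * _ * _]mulrA Pq mulr1.
apply/funext => -[|b a].
  by rewrite seriesD seriesM0 !ser_nil L1 mul0r addr0 mP.1.
have Dl : der b (ser (log_succ Phi)) =
    der b (ser Phi) * subst (ser (conv_inv Phi)) (ser Phi).
  by apply/funext => c; exact: Lc.
have D : der b (ser (log_succ Phi) * ser Phi) = der b (ser Phi).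
  by rewrite derM ser_nil L1 scale0r add0r Dl -mulrA qP mulr1.
rewrite seriesD add0r; exact: (esym (congr1 (fun f => f a) D)).
Qed.

Lemma size_flatten_factors m a : (size (flatten (factors m a)) <= size a)%N.
Proof.
elim: m a => [|c m IH] [|x a] //=; case: c => /=; first exact: leqW.
by have := IH a; rewrite {1}factors_cons /= !size_cat.
Qed.

Lemma bar_ind (P : Hb -> Prop) : P 1 ->
  (forall b a ss, nonnil ss ->
     (forall ss', (size (flatten ss') <= size a + size (flatten ss))%N ->
       P (bar ss')) ->
     P (bar ((b :: a) :: ss))) ->
  forall ss, P (bar ss).
Proof.
move=> P1 PS ss; have [n] := ubnP (size (flatten ss)).
(* Empty words, being factors 1, are dropped, so that the first word has a letter to lose and the
   total length decreases. *)
elim: n ss => // n IH ss; rewrite -bar_filter.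
have -> : flatten ss = flatten [seq a <- ss | ~~ nilp a].
  by elim: ss => [|[|x a] ss E] //=; rewrite E.
case: {ss}[seq a <- ss | ~~ nilp a] (filter_all (fun a => ~~ nilp a) ss).
  by rewrite bar_nil.
case=> [//|b a] ss ss0; rewrite /= size_cat ltnS => le.
apply: PS => // ss' le'; apply: IH; exact: leq_ltn_trans le' le.
Qed.

(** [alpha] already receives a word starting with [b] and kills products, so [ss] passes entirely to
    [G]. *)
Lemma tensor_gamma_prec alpha G b a ss : g_H A alpha -> scalar G ->
  nonnil ss ->
  tensor_form alpha G (Delta_prec_plus (bar ((b :: a) :: ss))) =
  \sum_(m <- masks (size a))
    alpha (bword (b :: mask m a)) * G (bar (factors m a ++ ss)).
Proof.
move=> ga lG n; have la := let: And3 l _ _ := ga in l.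
have ls := @counit_scalar k A.
rewrite Delta_prec_plus_bar // tensor_cop_prec //; apply: eq_bigr => m _.
set u := bword _; set z := bar _; have lG' := scalar_mull z lG.
rewrite (_ : (fun x => alpha (u * x)) = fun x => alpha u * counit x).
  by rewrite tensor_formZl // Delta_counitl // /z -bar_cat.
by apply/funext => x; rewrite g_HM // counit_bword mul0r addr0.
Qed.

(** Here [alpha] receives a gap starting with [b], so [ss] stays entirely with [F]. *)
Lemma tensor_gamma_succ alpha F b a ss : g_H A alpha -> scalar F ->
  nonnil ss ->
  tensor_form F alpha (Delta_succ_plus (bar ((b :: a) :: ss))) =
  \sum_(m <- masks (size a)) F (bar (mask m a :: ss)) *
    alpha (bar ((b :: head [::] (factors m a)) :: behead (factors m a))).
Proof.
move=> ga lF n; have la := let: And3 l _ _ := ga in l.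
have ls := @counit_scalar k A.
rewrite Delta_succ_plus_bar // tensor_cop_succ //; apply: eq_bigr => m _.
set u := bword _; set z := bar _; have lF' := scalar_mull u lF.
rewrite (_ : (fun x => alpha (z * x)) = fun x => alpha z * counit x).
  by rewrite tensor_formZr // Delta_counitr // mulrC bar_cons.
apply/funext => x; rewrite g_HM // {2}/z bar_cons counitM counit_bword.
by rewrite !mul0r addr0.
Qed.

Lemma gamma_factors alpha b m a : g_H A alpha ->
  alpha (bar ((b :: head [::] (factors m a)) :: behead (factors m a))) =
  der b (ser alpha) (head [::] (factors m a)) *
  \prod_(J <- behead (factors m a)) (1 : series) J.
Proof.
move=> ga; rewrite bar_cons g_HM // counit_bword mul0r addr0.
by rewrite (char_bar _ (@counit_monoid _ _)) ser_counit.
Qed.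

Lemma E_precP alpha : g_H A alpha -> G_H A (E_prec alpha) /\
  ser (E_prec alpha) = 1 + subst (ser alpha) (ser (E_prec alpha)).
Proof.
move=> ga; have [la a1 _] := ga; have ls := @counit_scalar k A.
pose f := series_fix (fun M => 1 + subst (ser alpha) M).
have Ef : f = 1 + subst (ser alpha) f := series_fixE (@free_contraction _ _ _).
have f1 : f [::] = 1 by exact: (free_nil _ Ef).
have lf : multilin f by apply: multilin_free Ef; exact: ser_multilin.
have GF := char_ofG lf; have sF := ser_char_of lf f1.
set F := char_of f in GF sF; have [lF mF] := GF.
(* The character built from the solution [f] on words solves the equation on bar-words, since the
   later words factor out. *)
have solF : F = counit \+ half_prec alpha F.
  apply: form_ext => //.
    by apply: scalar_add => //; apply: half_prec_scalar => //; exact: mF.1.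
  case=> [|[//|b a] ss] n.
    by rewrite bar_nil /= mF.1 counit1 half_prec1 // addr0.
  have ss0 : nonnil ss by move: n; rewrite nonnil_cons => /andP[].
  rewrite /= half_precE //; last exact: mF.1.
  rewrite tensor_gamma_prec // bar_cons counitM counit_bword mul0r add0r mF.2.
  under eq_bigr => m _ do rewrite bar_cat mF.2 mulrA.
  rewrite -mulr_suml sum_prec // sF -[F (bword _)]/(ser F (b :: a)) sF.
  by rewrite {1}Ef seriesD add0r.
suff -> : E_prec alpha = F by split=> //; rewrite sF.
pose P : set form := [set Phi | scalar Phi /\ Phi =
  counit \+ half_prec alpha Phi]%classic.
have [lE solE] : P (E_prec alpha) by apply: (@xgetPex _ counit P); exists F.
set Phi := E_prec alpha in lE solE *.
have E1 : Phi 1 = 1 by rewrite solE /= counit1 half_prec1 // addr0.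
(* Uniqueness among all linear solutions: [alpha] uses up the letter [b], so the unknown is
   evaluated on fewer letters. *)
apply: form_ext => // ss _; apply: (@bar_ind (fun x => Phi x = F x)) => {ss}.
  by rewrite E1 mF.1.
move=> b a ss ss0 IH; rewrite solE solF /= !half_precE //; last exact: mF.1.
congr (_ + _); rewrite !tensor_gamma_prec //; apply: eq_bigr => m _.
congr (_ * _); apply: IH; rewrite flatten_cat size_cat leq_add2r.
exact: size_flatten_factors.
Qed.

Lemma boolean_contraction (b : series) :
  b [::] = 0 -> contraction (fun M => 1 + b * M).
Proof.
move=> b0 n f g fg; apply: agreeD => //; apply: agreeMl => //.
Qed.

Lemma multilin_boolean (b : series) f : b [::] = 0 -> multilin b ->
  f = 1 + b * f ->
  multilin f.
Proof.
move=> b0 lb; apply: multilin_fix (boolean_contraction b0) => g lg.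
by apply: multilinD; [exact: multilin1 | exact: multilinM].
Qed.

Lemma boolean_nil (b f : series) : b [::] = 0 -> f = 1 + b * f -> f [::] = 1.
Proof. by move=> b0 ->; rewrite seriesD seriesM0 b0 mul0r addr0. Qed.

(** [alpha] kills products, so all gaps but the first are empty and the kept letters form a suffix:
    the sum is a Cauchy product. *)
Lemma sum_gamma_succ alpha F b a ss : g_H A alpha ->
  \sum_(m <- masks (size a)) F (bar (mask m a :: ss)) *
    alpha (bar ((b :: head [::] (factors m a)) :: behead (factors m a))) =
  (der b (ser alpha) * (fun u => F (bword u * bar ss))) a.
Proof.
move=> ga; have H := mask_sumE (fun u => F (bword u * bar ss)) (der b (ser
  alpha)) 1.
rewrite subst1 in H; rewrite -H; apply: eq_bigr => m _.
by rewrite gamma_factors // bar_cons.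
Qed.

Lemma E_succP alpha : g_H A alpha -> G_H A (E_succ alpha) /\
  ser (E_succ alpha) = 1 + ser alpha * ser (E_succ alpha).
Proof.
move=> ga; have [la a1 _] := ga; have ls := @counit_scalar k A.
pose f := series_fix (fun M => 1 + ser alpha * M).
have Ef : f = 1 + ser alpha * f := series_fixE (boolean_contraction a1).
have f1 : f [::] = 1 by exact: (boolean_nil _ Ef).
have lf : multilin f by apply: multilin_boolean Ef => //; exact: ser_multilin.
have GF := char_ofG lf; have sF := ser_char_of lf f1.
set F := char_of f in GF sF; have [lF mF] := GF.
have solF : F = counit \+ half_succ F alpha.
  apply: form_ext => //.
    by apply: scalar_add => //; apply: half_succ_scalar => //; exact: mF.1.
  case=> [|[//|b a] ss] n.
    by rewrite bar_nil /= mF.1 counit1 half_succ1 // addr0.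
  have ss0 : nonnil ss by move: n; rewrite nonnil_cons => /andP[].
  rewrite /= half_succE //; last exact: mF.1.
  rewrite tensor_gamma_succ // bar_cons counitM counit_bword mul0r add0r mF.2.
  rewrite sum_gamma_succ //.
  have -> : (fun u => F (bword u * bar ss)) = F (bar ss) *: f :> series.
    by apply/funext => u; rewrite mF.2 seriesZ mulrC -sF.
  rewrite -series_scaleAr seriesZ mulrC; congr (_ * _).
  rewrite -[F (bword _)]/(ser F (b :: a)) sF {1}Ef seriesD add0r.
  rewrite -[LHS]/(der b (ser alpha * f) a) derM seriesD seriesZ.
  by rewrite ser_nil a1 mul0r add0r.
suff -> : E_succ alpha = F by split=> //; rewrite sF.
pose P : set form := [set Phi | scalar Phi /\ Phi =
  counit \+ half_succ Phi alpha]%classic.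
have [lE solE] : P (E_succ alpha) by apply: (@xgetPex _ counit P); exists F.
set Phi := E_succ alpha in lE solE *.
have E1 : Phi 1 = 1 by rewrite solE /= counit1 half_succ1 // addr0.
apply: form_ext => // ss _; apply: (@bar_ind (fun x => Phi x = F x)) => {ss}.
  by rewrite E1 mF.1.
move=> b a ss ss0 IH; rewrite solE solF /= !half_succE //; last exact: mF.1.
(* Membership in [masks] is retained because it bounds the number of kept letters by the length of
   [a]. *)
congr (_ + _); rewrite !tensor_gamma_succ // big_seq [RHS]big_seq.
apply: eq_bigr => m; rewrite mem_masks => /eqP sm; congr (_ * _); apply: IH.
rewrite /= size_cat leq_add2r size_mask // -sm; exact: count_size.
Qed.

(** * The maps [BB t] on Boolean cumulants *)

Lemma BB_spec (t : k) Phi : 1 + t != 0 -> G_H A Phi ->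
  G_H A (BB t Phi) /\ exists b c : series,
    [/\ b [::] = 0, ser Phi = 1 + b * ser Phi,
        ser (BB t Phi) = 1 + c * ser (BB t Phi) & bn_rel t b c].
Proof.
move=> t0 GP; have [gk Ek] := log_precP GP; have [gb Eb] := log_succP GP.
have [GPsi Ek'] := E_precP (g_HZ (1 + t) gk).
set Psi := E_prec _ in GPsi Ek'; have [gb' Eb'] := log_succP GPsi.
have [GB EB] := E_succP (g_HZ (1 + t)^-1 gb'); split; first exact: GB.
exists (ser (log_succ Phi)), (ser ((1 + t)^-1 \*o log_succ Psi)).
split=> //; first exact: ser_gamma_nil.
(* Time 1 leads from the free cumulants of [Phi] to its Boolean ones, and likewise for [Psi], whose
   free cumulants are [1 + t] times those of [Phi]. *)
have kb := bn_rel_boolean Ek Eb; have kb' := bn_rel_boolean Ek' Eb'.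
set kappa := ser (log_prec Phi) in kb *; rewrite ser_gHZ -/kappa in kb'.
set b' := ser (log_succ Psi) in kb'; set b := ser (log_succ Phi) in kb *.
have b0 : b [::] = 0 by exact: ser_gamma_nil.
have k0 : kappa [::] = 0 by exact: ser_gamma_nil.
(* Rescaling turns the relation for [Psi] into one of time [1 + t] that starts at [kappa]. *)
have kc : bn_rel (1 + t) kappa ((1 + t)^-1 *: b').
  rewrite -[X in bn_rel X]mul1r; apply: bn_rel_scale => //.
  by rewrite scalerA divff // scale1r.
(* Time [1 + t] from [kappa] is also reached through [b], by time 1 and then [t]; both routes end at
   the same series. *)
have [d bd] := bn_rel_total t b0.
rewrite ser_gHZ -/b'; suff -> : (1 + t)^-1 *: b' = d by [].
apply: bn_rel_fun kc _ => //; rewrite addrC; exact: bn_rel_comp kb bd.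
Qed.

Lemma boolean_uniq (b c f : series) : f [::] = 1 -> f = 1 + b * f ->
  f = 1 + c * f -> b = c.
Proof.
move=> f1 Eb Ec; apply: (mulIr_series f1); apply: (addrI 1).
by rewrite -Eb -Ec.
Qed.

Lemma G_H_boolean_ext (b : series) F G : b [::] = 0 -> G_H A F -> G_H A G ->
  ser F = 1 + b * ser F -> ser G = 1 + b * ser G -> F = G.
Proof.
move=> b0 GF GG EF EG; apply: G_H_ext => //.
exact: (contraction_uniq (boolean_contraction b0)).
Qed.

Lemma BB_bij (t : k) : 1 + t != 0 -> set_bij (G_H A) (G_H A) (BB t).
Proof.
move=> t0; split.
- by move=> Phi GP; have [] := BB_spec t0 GP.
- move=> Phi Phi'; rewrite !inE => GP GP' E.
  have [GB [b [c [b0 Eb Ec bc]]]] := BB_spec t0 GP.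
  have [_ [b' [c' [b'0 Eb' Ec' bc']]]] := BB_spec t0 GP'.
  have cc : c = c'.
    by rewrite -E in Ec'; apply: boolean_uniq Ec Ec'; exact: GB.2.1.
  have c0 := bn_rel_nil b0 bc.
  (* Going back by time [- t] from the common image recovers both [b] and [b'], since time 0 is the
     identity. *)
  have [d cd] := bn_rel_total (- t) c0.
  have bd : b = d.
    by apply: bn_rel_fun (bn_rel0 b) _ => //; rewrite -(addNr t);
      exact: bn_rel_comp bc cd.
  have b'd : b' = d.
    apply: bn_rel_fun (bn_rel0 b') _ => //; rewrite -(addNr t).
    by rewrite cc in cd; exact: bn_rel_comp bc' cd.
  have bb' : b = b' by rewrite bd.
  by rewrite -bb' in Eb'; exact: G_H_boolean_ext b0 GP GP' Eb Eb'.
- move=> Psi GP; have [gc Ec] := log_succP GP;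
  set c := ser (log_succ Psi) in Ec.
  have c0 : c [::] = 0 by exact: ser_gamma_nil.
  have lc : multilin c by apply: ser_multilin; case: gc.
  (* The preimage is the character whose Boolean cumulants are those of [Psi] moved by time
     [- t]. *)
  have [b cb] := bn_rel_total (- t) c0; have b0 := bn_rel_nil c0 cb.
  pose f := series_fix (fun M => 1 + b * M).
  have Ef : f = 1 + b * f := series_fixE (boolean_contraction b0).
  have f1 := boolean_nil b0 Ef.
  have lf : multilin f.
    by apply: multilin_boolean Ef => //; exact: bn_rel_multilin c0 lc cb.
  have GF := char_ofG lf; have sF := ser_char_of lf f1.
  exists (char_of f) => //.
  have [GB [b' [c' [b'0 Eb' Ec' bc']]]] := BB_spec t0 GF.
  have bb : b' = b by rewrite sF in Eb'; exact: boolean_uniq f1 Eb' Ef.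
  have cc : c = c'.
    apply: bn_rel_fun (bn_rel0 c) _ => //; rewrite -(subrr t).
    by rewrite bb in bc'; exact: bn_rel_comp cb bc'.
  by apply: (@G_H_boolean_ext c) => //; rewrite {1}cc.
Qed.

Lemma BB_comp (s t : k) Phi : 1 + s != 0 -> 1 + t != 0 -> 1 + (t + s) != 0 ->
  G_H A Phi -> BB t (BB s Phi) = BB (t + s) Phi.
Proof.
move=> s0 t0 ts0 GP.
have [GB [b [c [b0 Eb Ec bc]]]] := BB_spec s0 GP.
have [GB' [c' [d [c'0 Ec' Ed c'd]]]] := BB_spec t0 GB.
have [GB2 [b' [d' [b'0 Eb' Ed' b'd']]]] := BB_spec ts0 GP.
have cc : c = c' by apply: boolean_uniq Ec Ec'; exact: GB.2.1.
have bb : b' = b by apply: boolean_uniq Eb' Eb; exact: GP.2.1.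
have dd : d = d'.
  rewrite cc in bc; rewrite bb in b'd'.
  exact: bn_rel_fun b0 (bn_rel_comp bc c'd) b'd'.
rewrite dd in Ed.
exact: G_H_boolean_ext (bn_rel_nil b'0 b'd') GB' GB2 Ed Ed'.
Qed.

End FixedPoints.

Theorem mainTheorem15 (R : realType) (k : fieldType) (iota : {rmorphism R -> k})
    (char_k : [pchar k] =i pred0)
    (A : algType k) (phi : {scalar A}) (phi1 : phi 1 = 1) :
  (forall t : R, 0 <= t -> set_bij (G_H A) (G_H A) (BB (iota t))) /\
  (forall s t : R, 0 <= s -> 0 <= t ->
     forall Phi : Hbar A -> k, G_H A Phi ->
       BB (iota t) (BB (iota s) Phi) = BB (iota (t + s)) Phi).
Proof.
(* [1 + iota t] is the image of the positive real [1 + t] under an injective morphism. *)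
have nz (t : R) : 0 <= t -> 1 + iota t != 0.
  move=> t0; rewrite -(rmorph1 iota) -rmorphD fmorph_eq0.
  by rewrite Order.POrderTheory.gt_eqF // ltr_pwDl.
split=> [t t0|s t s0 t0 Phi GP]; first by apply: BB_bij; exact: nz.
rewrite rmorphD; apply: BB_comp => //; [exact: nz|exact: nz|].
by rewrite -rmorphD; apply: nz; exact: addr_ge0.
Qed.
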